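(* There is an absolute constant $C>0$ such that the following holds. Fix $d,k\in\mathbb N$. Let $A=gg^\top$ where $g\in\mathbb R^{d^k}$ has iid standard normal entries, and let $x=x_1\otimes\cdots\otimes x_k$ with $x_1,\dots,x_k\in\mathbb R^d$ independent of each other and of $g$, each being a Rademacher vector or a $\mathcal N(0,I_d)$ vector. Then (i) with probability at least $3/4$ over $g$, $\operatorname{Var}[x^\top Ax\mid g]\le C(2+\tfrac1d)^k(\operatorname{tr}(A))^2$; and (ii) for every $\varepsilon\in(0,1)$ and every $\ell\ge C\,\varepsilon^{-2}(2+\tfrac1d)^k$, with probability at least $2/3$ (over $g$ and the query vectors), the Kronecker–Hutchinson estimator satisfies $(1-\varepsilon)\operatorname{tr}(A)\le H_\ell(A)\le(1+\varepsilon)\operatorname{tr}(A)$.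
   Context: A Rademacher vector has iid entries uniform on $\{\pm1\}$. The Kronecker–Hutchinson estimator with $\ell$ samples is $H_\ell(A)=\frac1\ell\sum_{j=1}^\ell (x^{(j)})^\top A x^{(j)}$, where $x^{(1)},\dots,x^{(\ell)}$ are iid copies of $x=x_1\otimes\cdots\otimes x_k$ (independent of $g$). *)

(* Defs.v *)
From HB Require Import structures.
From mathcomp Require Import all_boot all_order all_algebra.
From mathcomp Require Import all_classical all_reals all_analysis.
Set Implicit Arguments. Unset Strict Implicit. Unset Printing Implicit Defensive.
Import Order.TTheory GRing.Theory Num.Theory.
Local Open Scope classical_set_scope.
Local Open Scope ring_scope.


(* Coordinates of R^{d^k} = (R^d)^{\otimes k} are indexed by multi-indices
   J = (j_1,...,j_k) in [d]^k, i.e. by finite functions 'I_k -> 'I_d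
   (a finite type of cardinality d^k). *)
Definition Index (d k : nat) := {ffun 'I_k -> 'I_d}.

Definition kron {R : realType} (d k : nat) (x : 'I_k -> 'I_d -> R) : Index d k -> R :=
  fun J => \prod_(i < k) x i (J i).

Definition gram {R : realType} (n : finType) (g : n -> R) : n -> n -> R :=
  fun J J' => g J * g J'.

Definition qform {R : realType} (n : finType) (A : n -> n -> R) (x : n -> R) : R :=
  \sum_(J : n) \sum_(J' : n) x J * A J J' * x J'.

Definition trace {R : realType} (n : finType) (A : n -> n -> R) : R := \sum_(J : n) A J J.

Definition mutually_independent {R : realType} {dT} {T : measurableType dT}
    (P : probability T R) (I : finType) (X : I -> T -> R) : Prop :=
  forall (S : {set I}) (B : I -> set R), (forall i, measurable (B i)) ->
    P (\bigcap_(i in [set i | i \in S]) (X i @^-1` B i)) =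
    (\prod_(i in S) P (X i @^-1` B i))%E.

Definition std_normal_rv {R : realType} {dT} {T : measurableType dT}
    (P : probability T R) (X : T -> R) : Prop :=
  measurable_fun setT X /\
  forall B : set R, measurable B -> P (X @^-1` B) = normal_prob 0 1 B.

Definition rademacher_rv {R : realType} {dT} {T : measurableType dT}
    (P : probability T R) (X : T -> R) : Prop :=
  measurable_fun setT X /\
  P (X @^-1` [set 1]) = (1 / 2)%:E /\ P (X @^-1` [set -1]) = (1 / 2)%:E.

(* each x_i is a Rademacher vector (kind i = true) or N(0, I_d) (kind i = false);
   both mean iid entries with the corresponding scalar law *)
Definition entry_law {R : realType} {dT} {T : measurableType dT}
    (P : probability T R) (rad : bool) (X : T -> R) : Prop :=
  if rad then rademacher_rv P X else std_normal_rv P X.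

Definition joint1 {R : realType} {T} (d k : nat) (g : Index d k -> T -> R)
    (x : 'I_k -> 'I_d -> T -> R) : (Index d k + ('I_k * 'I_d))%type -> T -> R :=
  fun s => match s with inl J => g J | inr p => x p.1 p.2 end.

Definition jointl {R : realType} {T} (d k l : nat) (g : Index d k -> T -> R)
    (x : 'I_l -> 'I_k -> 'I_d -> T -> R) :
    (Index d k + ('I_l * 'I_k * 'I_d))%type -> T -> R :=
  fun s => match s with inl J => g J | inr p => x p.1.1 p.1.2 p.2 end.

(* Var[x^T A x | g], evaluated at g = gamma: since x is independent of g,
   this is the variance over x of x^T (gamma gamma^T) x. *)
Definition cond_var {R : realType} {dT} {T : measurableType dT} (P : probability T R)
    (d k : nat) (x : 'I_k -> 'I_d -> T -> R) (gamma : Index d k -> R) : \bar R :=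
  'V_P[fun w => qform (gram gamma) (kron (fun i a => x i a w))].

Definition hutch {R : realType} (d k l : nat) (A : Index d k -> Index d k -> R)
    (x : 'I_l -> 'I_k -> 'I_d -> R) : R :=
  l%:R^-1 * \sum_(j < l) qform A (kron (x j)).

(* Main.v *)
Require Import Defs.
From HB Require Import structures.
From mathcomp Require Import all_boot all_order all_algebra.
From mathcomp Require Import all_classical all_reals all_analysis.
From mathcomp Require Import measurable_realfun ring lra.
Set Implicit Arguments. Unset Strict Implicit. Unset Printing Implicit Defensive.
Import Order.TTheory GRing.Theory Num.Theory.
Import numFieldNormedType.Exports.
Local Open Scope classical_set_scope.
Local Open Scope ring_scope.

(* Write q = (g . x)^2 = x^T A x, tr = |g|^2 and D = d^k.  Given x, the variable
   g . x is centred Gaussian with variance |x|^2, so E[q^2] = 3 E|x|^4, and the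
   product structure of x gives E|x|^4 <= (d^2 + 2d)^k <= D^2 (2 + 1/d)^k.  On the
   other hand tr >= D / 512 with probability at least 7/8.
   (i) Var[q | g] is at most E[q^2 | g], whose expectation is E[q^2]: apply
   Markov's inequality.
   (ii) Given g, q is an unbiased estimator of tr, so the centred samples are
   orthogonal and E[(H - tr)^2] <= E[q^2] / l: apply Markov's inequality again. *)

(** * Change of variables with a weight *)

(** Independence is given for events only and no product space is assumed, so conditioning on g is
    never literal. Two devices replace it: q - tr is tested against polynomials in the variables
    other than those of x, which stands for conditional unbiasedness, and the second moment at fixed
    g is written as an explicit polynomial in g. Everything then reduces to expectations of
    monomials in independent variables having moments of all orders.

    The lower tail of tr has to be controlled for every D, down to D = 1, where a variance bound on
    tr is too weak. Counting the coordinates of g that are not small works uniformly in D.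

    Constants: Markov's inequality at 8 times the mean costs probability 1/8, and the trace costs
    another 1/8. Eight times the mean bound 3 D^2 (2 + 1/d)^k, combined with D <= 512 tr, gives C =
    24 * 512^2 in both parts. *)

Section weighted_change_of_variables.
Local Open Scope ereal_scope.
Context d1 d2 (X : measurableType d1) (Y : measurableType d2) (R : realType).
Variables (mu : {measure set X -> \bar R}) (nu : {measure set Y -> \bar R}).
Variables (phi : X -> Y) (g : X -> R).
Hypothesis mphi : measurable_fun setT phi.
Hypothesis mg : measurable_fun setT g.
Hypothesis g0 : forall x, (0 <= g x)%R.
Hypothesis nuE : forall B, measurable B ->
  nu B = \int[mu]_(x in phi @^-1` B) (g x)%:E.

Import HBNNSimple.

(** One statement covers three uses: a density ([phi] the identity), the law of a variable ([g]
    constant 1), and, for independence, one variable weighted by the product of the other factors.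
    Monotone convergence and linearity reduce it to indicators, where it is [nuE]. *)
Lemma ge0_integral_weighted (f : Y -> \bar R) : measurable_fun setT f ->
  (forall y, 0 <= f y) -> \int[nu]_y f y = \int[mu]_x (f (phi x) * (g x)%:E).
Proof.
move=> mf f0; pose f_ := nnsfun_approx measurableT mf.
have mgE : measurable_fun setT (EFin \o g) by exact/measurable_EFinP.
have mfphi n : measurable_fun setT (fun x => (f_ n (phi x))%:E).
  by apply/measurable_EFinP; exact: measurableT_comp.
transitivity (limn (fun n => \int[nu]_y (f_ n y)%:E)).
  rewrite -monotone_convergence//.
  - apply: eq_integral => y _; apply/esym/cvg_lim => //.
    exact: cvg_nnsfun_approx.
  - by move=> n; exact/measurable_EFinP/measurable_funP.
  - by move=> n y _; rewrite lee_fin.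
  - by move=> y _ m n mn; rewrite lee_fin; exact/lefP/nd_nnsfun_approx.
transitivity (limn (fun n => \int[mu]_x ((f_ n (phi x))%:E * (g x)%:E))); last first.
  rewrite -monotone_convergence//.
  - apply: eq_integral => x _; apply/cvg_lim => //; apply: cvgeZr => //.
    exact: (@cvg_nnsfun_approx _ _ _ _ measurableT _ mf (fun y _ => f0 y)).
  - by move=> n; exact: emeasurable_funM.
  - by move=> n x _; rewrite mule_ge0 ?lee_fin.
  - move=> x _ m n mn; rewrite lee_wpmul2r ?lee_fin//.
    exact/lefP/nd_nnsfun_approx.
congr (limn _); apply/funext => n.
have mpre r : measurable (phi @^-1` (f_ n @^-1` [set r])).
  by rewrite -(setTI (_ @^-1` _)); exact: mphi.
under eq_integral do rewrite fimfunE -fsumEFin//.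
rewrite ge0_integral_fsum//; last 2 first.
- by move=> r; exact/measurable_EFinP/measurable_funM.
- by move=> r y _; rewrite nnfun_muleindic_ge0.
transitivity (\int[mu]_x (\sum_(r \in range (f_ n))
    (r * \1_(f_ n @^-1` [set r]) (phi x))%:E * (g x)%:E)); last first.
  apply: eq_integral => x _.
  rewrite -ge0_mule_fsuml => [|r]; last exact: nnfun_muleindic_ge0.
  by rewrite fsumEFin// -fimfunE.
have mrphi r : measurable_fun setT
    (fun x => (r * \1_(f_ n @^-1` [set r]) (phi x))%:E).
  apply/measurable_EFinP/measurable_funM => //.
  exact: measurableT_comp.
rewrite ge0_integral_fsum//; last 2 first.
- by move=> r; exact: emeasurable_funM.
- by move=> r x _; rewrite mule_ge0 ?lee_fin// -lee_fin nnfun_muleindic_ge0.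
apply: eq_fsbigr => r rf.
rewrite integralZl_indic_nnsfun// integral_indic// setIT nuE//.
under [RHS]eq_integral do rewrite EFinM -muleA.
rewrite [RHS]ge0_integralZl//.
- congr *%E; rewrite integral_mkcond; apply: eq_integral => x _.
  rewrite epatch_indic muleC; congr (_%:E * _).
- apply: emeasurable_funM => //; apply/measurable_EFinP.
  exact: measurableT_comp.
- by move=> x _; rewrite mule_ge0 ?lee_fin.
- by move: rf; rewrite inE => -[y _ <-]; rewrite lee_fin.
Qed.

Lemma integrable_weighted (f : Y -> R) : measurable_fun setT f ->
  nu.-integrable setT (EFin \o f) <->
  mu.-integrable setT (fun x => (f (phi x) * g x)%:E).
Proof.
move=> mf; have mfg : measurable_fun setT (fun x => (f (phi x) * g x)%:E).
  apply/measurable_EFinP; apply: measurable_funM => //.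
  exact: measurableT_comp.
have mabs : measurable_fun setT (fun y => `|(f y)%:E|).
  by apply: measurableT_comp => //; exact/measurable_EFinP.
have E : \int[nu]_x `|(EFin \o f) x| = \int[mu]_x `|(f (phi x) * g x)%:E|.
  rewrite ge0_integral_weighted//; apply: eq_integral => x _.
  by rewrite /= -EFinM normrM (ger0_norm (g0 x)).
split=> /integrableP[_ h]; apply/integrableP; split => //.
- by rewrite -E.
- exact/measurable_EFinP.
- by rewrite E.
Qed.

Lemma integral_weighted (f : Y -> R) : measurable_fun setT f ->
  \int[nu]_y (f y)%:E = \int[mu]_x (f (phi x) * g x)%:E.
Proof.
move=> mf; have mfE : measurable_fun setT (EFin \o f) by exact/measurable_EFinP.
rewrite integralE [RHS]integralE; congr (_ - _).
  rewrite ge0_integral_weighted//; last exact: measurable_funepos.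
  apply: eq_integral => x _.
  (* Multiplication by the nonnegative [g x] commutes with taking positive parts. *)
  by rewrite !funeposE/= -EFin_max -EFinM maxr_pMl// mul0r EFin_max.
rewrite ge0_integral_weighted//; last exact: measurable_funeneg.
apply: eq_integral => x _.
by rewrite !funenegE/= -EFin_max -EFinM maxr_pMl// mul0r mulNr EFin_max.
Qed.

End weighted_change_of_variables.

(** * Expectations of products of independent variables *)

Section independent_product.
Context (R : realType) (dT : measure_display) (T : measurableType dT).
Context (P : probability T R) (I : finType) (X : I -> T -> R).
Hypothesis mX : forall i, measurable_fun setT (X i).
Hypothesis indep : mutually_independent P X.

Let measurable_comp_prod (F : I -> R -> R) (Q : pred I) :
  (forall i, measurable_fun setT (F i)) ->
  measurable_fun setT (fun w => \prod_(i | Q i) F i (X i w)).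
Proof.
move=> mF; under eq_fun do rewrite -big_filter.
by apply: measurable_prod => i _; exact: measurableT_comp.
Qed.

(* The factors are generalized from indicators to nonnegative functions one at a
   time: outside the list s of the induction every F i is still an indicator. *)
Lemma ge0_integral_prod_independent (F : I -> R -> R) :
  (forall i, measurable_fun setT (F i)) -> (forall i y, 0 <= F i y) ->
  (forall i, P.-integrable setT (fun w => (F i (X i w))%:E)) ->
  (\int[P]_w (\prod_i F i (X i w))%:E =
   \prod_i \int[P]_w (F i (X i w))%:E)%E.
Proof.
move=> mF F0 iF.
(* The condition is vacuous at the start, as every index lies in [enum I]. *)
have : forall i, i \notin enum I -> exists B, measurable B /\ F i = \1_B.
  by move=> i; rewrite mem_enum.
elim: (enum I) F mF F0 iF => [|i s IHs] F mF F0 iF indicF.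
  (* All factors are now indicators, and the claim is independence for the full index set. *)
  have /choice[B HB] : forall i, exists B, measurable B /\ F i = \1_B.
    by move=> i; exact: indicF.
  have mB i := (HB i).1.
  have mXB i : measurable (X i @^-1` B i).
    by rewrite -(setTI (_ @^-1` _)); exact: mX.
  have := @indep [set: I]%SET B mB.
  have -> : \bigcap_(i in [set i | i \in [set: I]%SET]) X i @^-1` B i =
      [set w | forall i, B i (X i w)].
    apply/seteqP; split => w /= Bw i; first by apply: Bw; rewrite /= finset.in_setT.
    by move=> _; exact: Bw.
  have mBw : measurable [set w | forall i, B i (X i w)].
    rewrite (_ : [set w | _] = \bigcap_(i in [set: I]) (X i @^-1` B i)).
      by apply: fin_bigcap_measurable => // i _.
    by apply/seteqP; split => w /= Bw i *; exact: Bw.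
  under eq_bigl do rewrite finset.in_setT.
  have -> : (\prod_i P (X i @^-1` B i) = \prod_i \int[P]_w (F i (X i w))%:E)%E.
    apply: eq_bigr => i _; rewrite (HB i).2.
    under eq_integral do rewrite -[\1_(B i) _]/(\1_(X i @^-1` B i) _).
    by rewrite integral_indic// setIT.
  move=> <-; rewrite -[in RHS](setIT [set _ | _]) -integral_indic//.
  apply: eq_integral => w _; congr EFin.
  under eq_bigr do rewrite (HB _).2.
  have [/asboolP Bw|/asboolP Bw] := boolP `[< forall i, B i (X i w) >].
    rewrite [RHS]indicE mem_set// big1// => j _.
    by rewrite indicE mem_set//; exact: Bw.
  rewrite [RHS]indicE memNset//.
  by move/existsNP: Bw => [j Bj]; rewrite (bigD1 j)//= indicE memNset// mul0r.
pose W w := \prod_(j | j != i) F j (X j w).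
have mW : measurable_fun setT W by exact: measurable_comp_prod.
have W0 w : 0 <= W w by exact: prodr_ge0.
have fF j : (\int[P]_w (F j (X j w))%:E \is a fin_num)%E.
  exact: integrable_fin_num.
have IF0 j : 0 <= fine (\int[P]_w (F j (X j w))%:E)%E.
  by rewrite fine_ge0// integral_ge0// => w _; rewrite lee_fin.
pose c := \prod_(j | j != i) fine (\int[P]_w (F j (X j w))%:E)%E.
have c0 : 0 <= c by exact: prodr_ge0.
have cE : (\prod_(j | j != i) \int[P]_w (F j (X j w))%:E)%E = c%:E.
  rewrite /c; elim/big_ind2 : _ => // [a b a' b' -> ->|j _]; first by rewrite EFinM.
  by rewrite fineK.
pose Xi : {mfun T >-> R} := mfun_Sub (mem_set (mX i)).
(* As functions of [B], both sides are measures: the law of [X i] scaled by the integrals of the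
   other factors, and the [W]-weighted measure of the preimage. They agree by the induction
   hypothesis with factor [i] replaced by [\1_B]; integrating [F i] against both then removes the
   indicator. *)
have H B : measurable B ->
    mscale (NngNum c0) (distribution P Xi) B = (\int[P]_(w in X i @^-1` B) (W w)%:E)%E.
  move=> mB.
  have mXB : measurable (X i @^-1` B).
    by rewrite -(setTI (_ @^-1` _)); exact: mX.
  pose F' j : R -> R := if j == i then \1_B else F j.
  have F'i : F' i = \1_B by rewrite /F' eqxx.
  have F'j j : j != i -> F' j = F j by rewrite /F' => /negbTE ->.
  have EB : (\int[P]_w (\1_B (X i w))%:E = P (X i @^-1` B))%E.
    under eq_integral do rewrite -[\1_B _]/(\1_(X i @^-1` B) _).
    by rewrite integral_indic// setIT.
  have iB : P.-integrable setT (fun w => (\1_B (X i w))%:E).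
    exact: (@integrable_indic _ _ _ P (X i @^-1` B)).
  have : (\int[P]_w (\prod_j F' j (X j w))%:E =
          \prod_j \int[P]_w (F' j (X j w))%:E)%E.
    apply: IHs.
    - by move=> j; have [->|ji] := eqVneq j i; rewrite ?F'i ?F'j.
    - by move=> j y; have [->|ji] := eqVneq j i; rewrite ?F'i ?F'j.
    - by move=> j; have [->|ji] := eqVneq j i; rewrite ?F'i ?F'j.
    - move=> j js; have [->|ji] := eqVneq j i; first by rewrite F'i; exists B.
      by rewrite F'j//; apply: indicF; rewrite inE negb_or ji.
  rewrite (bigD1 i)//= F'i EB.
  rewrite (eq_bigr (fun j => \int[P]_w (F j (X j w))%:E)%E); last first.
    by move=> j ji; rewrite F'j.
  rewrite cE => IH; rewrite [RHS]integral_mkcond /mscale/= /distribution.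
  rewrite /pushforward/= muleC -[LHS]IH.
  apply: eq_integral => w _; rewrite (bigD1 i)//= F'i.
  rewrite (eq_bigr (fun j => F j (X j w))); last by move=> j ji; rewrite F'j.
  by rewrite epatch_indic mulrC EFinM.
rewrite (bigD1 i)//= cE.
under eq_integral do rewrite (bigD1 i)//= EFinM -/(W _).
have mFi : measurable_fun setT (EFin \o F i) by exact/measurable_EFinP.
rewrite -(ge0_integral_weighted (mX i) mW W0 H mFi); last first.
  by move=> y; rewrite lee_fin.
rewrite ge0_integral_mscale//; last by move=> y _; rewrite lee_fin.
rewrite [RHS]muleC; congr *%E; apply: ge0_integral_distribution => // y.
by rewrite lee_fin.
Qed.

(** The nonnegative case, applied to the absolute values of the factors, gives a finite product of
    finite integrals. *)
Lemma integrable_prod_independent (F : I -> R -> R) :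
  (forall i, measurable_fun setT (F i)) ->
  (forall i, P.-integrable setT (fun w => (F i (X i w))%:E)) ->
  P.-integrable setT (fun w => (\prod_i F i (X i w))%:E).
Proof.
move=> mF iF; apply/integrableP; split.
  by apply/measurable_EFinP; exact: measurable_comp_prod.
under eq_integral do rewrite abse_EFin normr_prod.
rewrite (ge0_integral_prod_independent (F := fun i y => `|F i y|))//.
- rewrite ltey_eq prode_fin_num// => i _; apply: integrable_fin_num => //.
  by have /integrable_norm := iF i.
- by move=> i; exact: measurableT_comp.
- by move=> i; have /integrable_norm := iF i.
Qed.

Lemma Rintegral_sum (J : Type) (s : seq J) (f : J -> T -> R) :
  (forall j, P.-integrable setT (EFin \o f j)) ->
  \int[P]_w (\sum_(j <- s) f j w) = \sum_(j <- s) \int[P]_w f j w.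
Proof.
move=> intf; elim: s => [|j s IHs].
  by rewrite big_nil; under eq_Rintegral do rewrite big_nil; rewrite Rintegral_cst// mul0r.
rewrite big_cons; under eq_Rintegral do rewrite big_cons.
rewrite RintegralD ?IHs//.
rewrite [X in integrable _ _ X](_ : _ = (fun w => \sum_(j <- s) (f j w)%:E)%E).
  by apply: integrable_sum => // i _; exact: intf.
by apply/funext => w; rewrite /= sumEFin.
Qed.

(** Each factor is a signed sum over [bool] of its positive and negative parts. Distributing the
    product turns both sides into sums over sign choices, and the nonnegative case applies to each
    term. *)
Lemma Rintegral_prod_independent (F : I -> R -> R) :
  (forall i, measurable_fun setT (F i)) ->
  (forall i, P.-integrable setT (fun w => (F i (X i w))%:E)) ->
  \int[P]_w (\prod_i F i (X i w)) = \prod_i \int[P]_w (F i (X i w)).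
Proof.
move=> mF iF.
pose s (b : bool) : R := if b then 1 else -1.
pose G b i := if b then (F i)^\+ else (F i)^\-.
have mG b i : measurable_fun setT (G b i).
  by case: b; [exact: measurable_funrpos|exact: measurable_funrneg].
have G0 b i y : 0 <= G b i y by case: b; rewrite ?funrpos_ge0 ?funrneg_ge0.
have iG b i : P.-integrable setT (fun w => (G b i (X i w))%:E).
  have := iF i; case: b.
    by move/(integrable_funrpos measurableT).
  by move/(integrable_funrneg measurableT).
have FE i y : F i y = \sum_(b : bool) s b * G b i y.
  by rewrite -{1}[F i]funrposBneg big_bool/= mul1r mulN1r.
under eq_Rintegral => w _ do under eq_bigr do rewrite FE.
under eq_Rintegral => w _ do rewrite bigA_distr_bigA.
rewrite Rintegral_sum.
- transitivity (\prod_i \sum_(b : bool) s b * \int[P]_w G b i (X i w)).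
    rewrite bigA_distr_bigA; apply: eq_bigr => /= f _.
    rewrite big_split/=; under eq_Rintegral do rewrite big_split/=.
    rewrite RintegralZl//; last first.
      exact: (integrable_prod_independent (F := fun i => G (f i) i)).
    congr *%R; rewrite /Rintegral.
    rewrite (ge0_integral_prod_independent (F := fun i => G (f i) i))//.
    rewrite (eq_bigr (fun i => (\int[P]_w (G (f i) i (X i w)))%:E)) ?prodEFin//.
    by move=> i _; rewrite fineK// integrable_fin_num.
  apply: eq_bigr => i _; under [RHS]eq_Rintegral do rewrite FE.
  rewrite Rintegral_sum.
    by apply: eq_bigr => b _; rewrite RintegralZl//; exact: iG.
  move=> b; exact: (integrableZl measurableT (s b) (iG b i)).
- move=> /= f.
  apply: (integrable_prod_independent (F := fun i y => s (f i) * G (f i) i y)).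
    by move=> i; exact: measurable_funM.
  move=> i; exact: (integrableZl measurableT (s (f i)) (iG (f i) i)).
Qed.

End independent_product.

(** * Polynomials in independent variables *)

Section polynomials_in_independent_variables.
Context (R : realType) (dT : measure_display) (T : measurableType dT).
Context (P : probability T R) (I : finType) (X : I -> T -> R).
Hypothesis mX : forall i, measurable_fun setT (X i).
Hypothesis indep : mutually_independent P X.
Hypothesis iX : forall i n, P.-integrable setT (fun w => (X i w ^+ n)%:E).

Implicit Types (S : {set I}) (f h : T -> R).

(** Exponents range over all of [I], a support being expressed by zero exponents; products of
    monomials then just add exponents. *)
Definition monom (e : I -> nat) (w : T) : R := \prod_i X i w ^+ e i.

(* An inductive presentation of linear combinations of monomials supported on
   S, so that identities between expectations follow by linearity from the case
   of monomials. *)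
Inductive poly_in S : (T -> R) -> Prop :=
| poly_in0 : poly_in S (fun=> 0)
| poly_in_cons (c : R) (e : I -> nat) f : (forall i, i \notin S -> e i = 0%N) ->
    poly_in S f -> poly_in S (fun w => c * monom e w + f w).

Lemma eq_poly_in S f h : f =1 h -> poly_in S f -> poly_in S h.
Proof. by move=> /funext ->. Qed.

Lemma sub_poly_in S S' f : S \subset S' -> poly_in S f -> poly_in S' f.
Proof.
move=> /fintype.subsetP SS'; elim=> [|c e {}f eS _ IH]; first exact: poly_in0.
by apply: poly_in_cons => // i iS'; apply: eS; apply: contra iS' => /SS'.
Qed.

Lemma poly_inD S f h : poly_in S f -> poly_in S h -> poly_in S (fun w => f w + h w).
Proof.
move=> pf ph; elim: pf => [|c e {}f eS _ IH].
  by apply: eq_poly_in ph => w; rewrite add0r.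
by apply: (eq_poly_in _ (poly_in_cons c eS IH)) => w; rewrite addrA.
Qed.

Lemma monomM e e' w : monom e w * monom e' w = monom (fun i => e i + e' i)%N w.
Proof. by rewrite /monom -big_split; apply: eq_bigr => i _; rewrite exprD. Qed.

Lemma poly_in_monomM S c e f : (forall i, i \notin S -> e i = 0%N) ->
  poly_in S f -> poly_in S (fun w => c * monom e w * f w).
Proof.
move=> eS; elim=> [|c' e' {}f e'S _ IH].
  by apply: (eq_poly_in _ (poly_in0 S)) => w; rewrite mulr0.
have ee'S i : i \notin S -> (e i + e' i = 0)%N by move=> iS; rewrite eS ?e'S.
apply: (eq_poly_in _ (poly_in_cons (c * c') ee'S IH)) => w.
by rewrite -monomM; ring.
Qed.

Lemma poly_inM S f h : poly_in S f -> poly_in S h -> poly_in S (fun w => f w * h w).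
Proof.
move=> pf ph; elim: pf => [|c e {}f eS _ IH].
  by apply: (eq_poly_in _ (poly_in0 S)) => w; rewrite mul0r.
by apply: (eq_poly_in _ (poly_inD (poly_in_monomM c eS ph) IH)) => w; rewrite mulrDl.
Qed.

Lemma poly_in_cst S c : poly_in S (fun=> c).
Proof.
apply: (eq_poly_in _ (@poly_in_cons S c (fun=> 0%N) _ _ (poly_in0 S))) => // w.
by rewrite /monom big1 ?mulr1 ?addr0// => i _; rewrite expr0.
Qed.

Lemma poly_in_var S i : i \in S -> poly_in S (X i).
Proof.
move=> iS; have eS j : j \notin S -> nat_of_bool (j == i) = 0%N.
  by apply: contraNeq; rewrite eqb0 negbK => /eqP ->.
apply: (eq_poly_in _ (poly_in_cons 1 eS (poly_in0 S))) => // w.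
rewrite /monom (bigD1 i)//= eqxx expr1 big1 ?mulr1 ?mul1r ?addr0// => j /negbTE ->.
by rewrite expr0.
Qed.

Lemma poly_inN S f : poly_in S f -> poly_in S (fun w => - f w).
Proof.
move=> pf; apply: (eq_poly_in _ (poly_inM (poly_in_cst S (-1)) pf)) => w.
by rewrite mulN1r.
Qed.

Lemma poly_inB S f h : poly_in S f -> poly_in S h -> poly_in S (fun w => f w - h w).
Proof. by move=> pf ph; apply: poly_inD => //; exact: poly_inN. Qed.

Lemma poly_inX S f n : poly_in S f -> poly_in S (fun w => f w ^+ n).
Proof.
move=> pf; elim: n => [|n IH].
  by apply: (eq_poly_in _ (poly_in_cst S 1)) => w; rewrite expr0.
by apply: (eq_poly_in _ (poly_inM pf IH)) => w; rewrite exprS.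
Qed.

Lemma poly_in_sum S (J : Type) (r : seq J) (F : J -> T -> R) :
  (forall j, poly_in S (F j)) -> poly_in S (fun w => \sum_(j <- r) F j w).
Proof.
move=> pF; elim: r => [|j r IH].
  by apply: (eq_poly_in _ (poly_in0 S)) => w; rewrite big_nil.
by apply: (eq_poly_in _ (poly_inD (pF j) IH)) => w; rewrite big_cons.
Qed.

Lemma poly_in_prod S (J : Type) (r : seq J) (F : J -> T -> R) :
  (forall j, poly_in S (F j)) -> poly_in S (fun w => \prod_(j <- r) F j w).
Proof.
move=> pF; elim: r => [|j r IH].
  by apply: (eq_poly_in _ (poly_in_cst S 1)) => w; rewrite big_nil.
by apply: (eq_poly_in _ (poly_inM (pF j) IH)) => w; rewrite big_cons.
Qed.

Let mpow n : measurable_fun setT (fun x : R => x ^+ n).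
Proof. by apply: measurable_funX; exact: measurable_id. Qed.

Lemma integrable_monom e : P.-integrable setT (EFin \o monom e).
Proof.
exact: (integrable_prod_independent mX indep (F := fun i y => y ^+ e i)).
Qed.

Lemma poly_in_integrable S f : poly_in S f -> P.-integrable setT (EFin \o f).
Proof.
elim=> [|c e {}f _ _ IH]; first exact: integrable0.
have := integrableD measurableT
  (integrableZl measurableT c (integrable_monom e)) IH.
exact.
Qed.

Lemma poly_in_measurable S f : poly_in S f -> measurable_fun setT f.
Proof. by move/poly_in_integrable/measurable_int/measurable_EFinP. Qed.

Local Notation "''E' f" := (Rintegral P setT f) (at level 10, f at level 8).

Lemma E_cst c : 'E (fun=> c) = c.
Proof. by rewrite Rintegral_cst//= probability_setT mulr1. Qed.

Lemma E_polyD S f h : poly_in S f -> poly_in S h ->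
  'E (fun w => f w + h w) = 'E f + 'E h.
Proof. by move=> /poly_in_integrable ? /poly_in_integrable ?; rewrite RintegralD. Qed.

Lemma E_polyB S f h : poly_in S f -> poly_in S h ->
  'E (fun w => f w - h w) = 'E f - 'E h.
Proof. by move=> /poly_in_integrable ? /poly_in_integrable ?; rewrite RintegralB. Qed.

Lemma E_polyZ S c f : poly_in S f -> 'E (fun w => c * f w) = c * 'E f.
Proof. by move=> /poly_in_integrable ?; rewrite RintegralZl. Qed.

Lemma E_poly_sum S (J : Type) (r : seq J) (F : J -> T -> R) :
  (forall j, poly_in S (F j)) ->
  'E (fun w => \sum_(j <- r) F j w) = \sum_(j <- r) 'E (F j).
Proof. by move=> pF; rewrite Rintegral_sum// => j; exact: poly_in_integrable (pF j). Qed.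

Lemma E_monom e : 'E (monom e) = \prod_i 'E (fun w => X i w ^+ e i).
Proof.
exact: (Rintegral_prod_independent mX indep (F := fun i y => y ^+ e i)).
Qed.

(** At every index one of the two exponents is 0, so each moment factors trivially, the other factor
    being the expectation of 1. *)
Lemma E_monomM S S' e e' : [disjoint S & S']%B ->
  (forall i, i \notin S -> e i = 0%N) -> (forall i, i \notin S' -> e' i = 0%N) ->
  'E (monom (fun i => e i + e' i)%N) = 'E (monom e) * 'E (monom e').
Proof.
move=> SS' eS e'S'; rewrite !E_monom -big_split/=; apply: eq_bigr => i _.
have E1 : 'E (fun w => X i w ^+ 0) = 1 by exact: E_cst.
have [iS|iS] := boolP (i \in S).
  by rewrite (e'S' i (negbT (disjointFr SS' iS))) addn0 E1 mulr1.
by rewrite (eS i iS) add0n E1 mul1r.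
Qed.

Lemma poly_in_setT S f : poly_in S f -> poly_in [set: I]%SET f.
Proof. by apply: sub_poly_in; exact: finset.subsetT. Qed.

Lemma poly_in_monom e : poly_in [set: I]%SET (monom e).
Proof.
apply: (eq_poly_in _ (@poly_in_cons [set: I]%SET 1 e _ _ (poly_in0 [set: I]%SET))) => [w|i].
  by rewrite mul1r addr0.
by rewrite finset.in_setT.
Qed.

(** Both sides are bilinear, so induction on each polynomial leaves a pair of monomials;
    disjointness enters only there. Intermediate sums are viewed as polynomials on the full index
    set, where additivity needs a single support. *)
Lemma E_polyM S S' f h : [disjoint S & S']%B -> poly_in S f -> poly_in S' h ->
  'E (fun w => f w * h w) = 'E f * 'E h.
Proof.
move=> SS' pf ph; elim: pf => [|c e {}f eS pf IH].
  by under eq_Rintegral do rewrite mul0r; rewrite E_cst mul0r.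
have {}ph' := poly_in_setT ph; have {}pf := poly_in_setT pf.
have pm e0 := poly_in_monom e0.
have pcm c' e0 := poly_inM (poly_in_cst _ c') (pm e0).
under eq_Rintegral do rewrite mulrDl.
rewrite (E_polyD (poly_inM (pcm _ _) ph') (poly_inM pf ph')).
rewrite (E_polyD (pcm _ _) pf) IH mulrDl; congr (_ + _).
under eq_Rintegral do rewrite -mulrA.
rewrite (E_polyZ c (poly_inM (pm e) ph')) (E_polyZ c (pm e)) -mulrA; congr *%R.
elim: {IH} ph {ph'} => [|c' e' {}h e'S ph IH].
  by under eq_Rintegral do rewrite mulr0; rewrite E_cst mulr0.
have {}ph := poly_in_setT ph.
under eq_Rintegral do rewrite mulrDr mulrCA.
rewrite (E_polyD (poly_inM (poly_in_cst _ c') (poly_inM (pm e) (pm e')))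
  (poly_inM (pm e) ph)).
rewrite (E_polyD (pcm _ _) ph) IH mulrDr; congr (_ + _).
rewrite (E_polyZ c' (poly_inM (pm e) (pm e'))) (E_polyZ c' (pm e')) mulrCA.
by under eq_Rintegral do rewrite monomM; rewrite (E_monomM SS' eS e'S).
Qed.

Lemma E_poly_prod (J : finType) (A : J -> {set I}) (F : J -> T -> R) :
  (forall j j', j != j' -> [disjoint A j & A j']%B) ->
  (forall j, poly_in (A j) (F j)) ->
  'E (fun w => \prod_j F j w) = \prod_j 'E (F j).
Proof.
move=> dA pF; have := index_enum_uniq J.
elim: (index_enum J) => [_|j r IH /= /andP[jr ur]].
  by rewrite big_nil; under eq_Rintegral do rewrite big_nil; rewrite E_cst.
under eq_Rintegral do rewrite big_cons.
rewrite big_cons -IH//.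
apply: (@E_polyM (A j) (\bigcup_(j' in J | j' \in r) A j')%SET) => //.
  rewrite -finset.setI_eq0; apply/eqP/finset.setP => i; rewrite !inE; apply/negbTE.
  apply/negP => /andP[ij /finset.bigcupP[j' /andP[_ j'r] ij']].
  have jj' : j != j' by apply: contraNneq jr => ->.
  by have := disjointFr (dA _ _ jj') ij; rewrite ij'.
(* [poly_in_prod] asks for every factor to be supported in the union, so those outside [r] are
   replaced by 1. *)
rewrite (_ : (fun w => _) =
    fun w => \prod_(j' <- r) if j' \in r then F j' w else 1); last first.
  by apply/funext => w; rewrite big_seq big_mkcond.
apply: (poly_in_prod _ (F := fun j' w => if j' \in r then F j' w else 1)) => j'.
case j'r: (j' \in r); last exact: poly_in_cst.
by apply: sub_poly_in (pF j'); rewrite (finset.bigcup_sup j')//= j'r.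
Qed.

End polynomials_in_independent_variables.

(** * Moments of the normal and Rademacher laws *)

Section improper_integral.
Context (R : realType).
Notation mu := (@lebesgue_measure R).

(** The fundamental theorem of calculus on growing symmetric intervals, then dominated convergence
    with bound [|f|]. *)
Lemma integral_derive_eq0 (F f : R -> R) :
  (forall x : R, is_derive x (1 : R) F (f x)) -> continuous f ->
  mu.-integrable setT (EFin \o f) ->
  F n%:R @[n --> \oo] --> (0 : R) -> F (- n%:R) @[n --> \oo] --> (0 : R) ->
  (\int[mu]_x (f x)%:E = 0)%E.
Proof.
move=> dF cf intf Fy FNy.
(* The successor keeps the interval nondegenerate, as [continuous_FTC2] requires. *)
pose D n : set R := `[- n.+1%:R, n.+1%:R]%classic.
have FTC n : (\int[mu]_(x in D n) (f x)%:E = (F n.+1%:R - F (- n.+1%:R))%:E)%E.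
  have cF x : {for x, continuous F}.
    by apply: differentiable_continuous; apply/derivable1_diffP; exact: ex_derive.
  rewrite (@continuous_FTC2 _ f F) ?EFinB//.
  - by rewrite (@lt_le_trans _ _ 0)// oppr_lt0 ltr0n.
  - exact: continuous_subspaceT.
  - split=> [x _||]; first exact: ex_derive.
    + exact/cvg_at_right_filter/cF.
    + exact/cvg_at_left_filter/cF.
  - by move=> x _; rewrite derive1E derive_val.
have mD n : measurable (D n) by exact: measurable_itv.
have mf : measurable_fun setT (EFin \o f) by exact: measurable_int intf.
have [||||| _ _ L] := @dominated_convergence _ _ _ mu setT measurableT
  (fun n => (EFin \o f) \_ (D n)) (EFin \o f) (abse \o (EFin \o f)).
- move=> n; have [h _] := measurable_restrictT (EFin \o f) (mD n); apply: h.
  exact: measurable_funTS.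
- exact: mf.
- apply/aeW => x _; apply: cvg_near_cst.
  near=> n; rewrite patchE ifT// inE /D/= in_itv/= -ler_norml.
  rewrite (le_trans (ltW (truncnS_gt `|x|)))// ler_nat ltnS.
  near: n; exact: nbhs_infty_ge.
- exact: integrable_abse.
- apply/aeW => x n _; rewrite patchE; case: ifP => _ //=.
  by rewrite normr0 lee_fin.
rewrite -(cvg_lim _ L)//; apply/cvg_lim => //.
rewrite (_ : [sequence _]_n = EFin \o (fun n => F n.+1%:R - F (- n.+1%:R))).
  apply: cvg_EFin; first exact: nearW.
  rewrite -[0]subr0; apply: cvgB; first by rewrite (cvg_shiftS (fun n => F n%:R)).
  by rewrite (cvg_shiftS (fun n => F (- n%:R))).
by apply/funext => n /=; rewrite -FTC [RHS]integral_mkcond.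
Unshelve. all: by end_near. Qed.

End improper_integral.

Section normal_moments.
Context (R : realType).
Notation mu := (@lebesgue_measure R).
Let phi : R -> R := normal_pdf 0 1.

Let phiE x : phi x = normal_peak 1 * expR (- (x ^+ 2 / 2)).
Proof.
by rewrite /phi normal_pdfE ?oner_eq0// /normal_fun subr0 expr1n mulNr.
Qed.

Let phi2E (x : R) : normal_pdf 0 2 x = normal_peak 2 * expR (- (x ^+ 2 / 8)).
Proof.
rewrite normal_pdfE// /normal_fun subr0 mulNr; congr (_ * expR (- (_ / _))).
by rewrite -mulr_natr; ring.
Qed.

Let phi_ge0 x : 0 <= phi x. Proof. exact: normal_pdf_ge0. Qed.

Let mphi : measurable_fun setT phi. Proof. exact: measurable_normal_pdf. Qed.

Let pow_le_expR n (y : R) : 0 <= y -> y ^+ n <= n`!%:R * expR y.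
Proof.
move=> y0; case: n => [|n].
  by rewrite fact0 expr0 mul1r (le_trans _ (expR_ge1Dx y))// lerDl.
rewrite mulrC -ler_pdivrMr ?ltr0n ?fact_gt0//.
by apply: le_trans (expR_ge1Dxn n y0); rewrite lerDr.
Qed.

(** Passing to a power of [x ^+ 2] avoids a case split on the parity of [n]. *)
Let norm_pow_le n (x : R) : `|x| ^+ n <= 1 + x ^+ 2 ^+ n.
Proof.
rewrite -[x ^+ 2]real_normK ?num_real// -exprM mulnC exprM.
set a := `|x| ^+ n.
by rewrite -subr_ge0; have := sqr_ge0 (a - 1/2); nra.
Qed.

(** The density of standard deviation 2 decays like exp(-x^2/8), slower than exp(-x^2/2) by a factor
    exp(3x^2/8), which absorbs any power of x. Being integrable and bounded, it yields both
    integrability of the moments and decay at infinity. *)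
Lemma pow_normal_pdf_le n :
  exists2 K : R, 0 <= K & forall x, `|x| ^+ n * normal_pdf 0 1 x <= K * normal_pdf 0 2 x.
Proof.
pose K := (normal_peak 1 / normal_peak 2) * (1 + (8 / 3) ^+ n * n`!%:R) : R.
have pk2 : (0 : R) < normal_peak 2 by rewrite normal_peak_gt0.
have pk1 : (0 : R) < normal_peak 1 by rewrite normal_peak_gt0// oner_eq0.
have K0 : 0 <= 1 + (8 / 3) ^+ n * n`!%:R :> R.
  by rewrite addr_ge0// mulr_ge0// exprn_ge0// divr_ge0.
exists K => [|x]; first by rewrite mulr_ge0// divr_ge0// ltW.
rewrite -/phi phiE phi2E /K.
(* The gap between the exponents; [x ^+ 2 = (8 / 3) * y] explains the [(8 / 3) ^+ n] in [K], and
   [y ^+ n <= n! * expR y] the factorial. *)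
set y := (3 * x ^+ 2) / 8.
have y0 : 0 <= y by rewrite divr_ge0// mulr_ge0// sqr_ge0.
have -> : - (x ^+ 2 / 8) = - (x ^+ 2 / 2) + y by rewrite /y; field.
rewrite expRD; set e := expR (- _).
have e0 : 0 <= e by exact: expR_ge0.
suff H : `|x| ^+ n <= (1 + (8 / 3) ^+ n * n`!%:R) * expR y.
  have -> : normal_peak 1 / normal_peak 2 * (1 + (8 / 3) ^+ n * n`!%:R) *
     (normal_peak 2 * (e * expR y)) =
     ((1 + (8 / 3) ^+ n * n`!%:R) * expR y) * (normal_peak 1 * e).
    by field; rewrite gt_eqF.
  by rewrite ler_wpM2r// mulr_ge0// ltW.
apply: (le_trans (norm_pow_le n x)); rewrite mulrDl mul1r lerD//.
  by rewrite (le_trans _ (expR_ge1Dx y))// lerDl.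
have -> : x ^+ 2 = (8 / 3) * y by rewrite /y; field.
by rewrite exprMn -mulrA ler_wpM2l ?pow_le_expR// exprn_ge0// divr_ge0.
Qed.

Lemma integrable_pow_normal_pdf n :
  mu.-integrable setT (fun x => (x ^+ n * normal_pdf 0 1 x)%:E).
Proof.
have [K K0 HK] := pow_normal_pdf_le n.
have := integrableZl measurableT K (integrable_normal_pdf (0 : R) 2).
apply: le_integrable => //.
  apply/measurable_EFinP; apply: measurable_funM; last exact: mphi.
  exact: exprn_measurable.
move=> x _ /=; rewrite lee_fin normrM normrX (ger0_norm (normal_pdf_ge0 _ _ _)).
by apply: le_trans (HK x) _; rewrite ler_norm.
Qed.

Let is_derive_phi (x : R) : is_derive x (1 : R) phi (- x * phi x).
Proof.
rewrite (_ : phi = fun x => normal_peak 1 * expR (- (x ^+ 2 / 2))); last first.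
  by apply/funext => y; rewrite phiE.
apply: is_derive_eq; rewrite /GRing.scale/= mulr0.
by field.
Qed.

Let is_derive_pow_phi n (x : R) :
  is_derive x (1 : R) (fun x => x ^+ n.+1 * phi x)
    (n.+1%:R * (x ^+ n * phi x) - x ^+ n.+2 * phi x).
Proof.
have d1 := is_derive_phi x.
have d2 := @is_deriveX _ _ id n.+1 x (1 : R) _ (is_derive_id x (1 : R)).
have := is_deriveM d2 d1.
rewrite (_ : id ^+ n.+1 * phi = (fun x => x ^+ n.+1 * phi x)); last first.
  by apply/funext => y; rewrite /GRing.mul/= exprfctE.
move=> d; apply: is_derive_eq d _; rewrite /GRing.scale/= exprfctE !exprS.
by ring.
Qed.

(** One extra power of [m] still leaves a bounded quantity, whence decay like 1/m. The sign [s]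
    treats both ends of the line. *)
Let cvg_pow_phi n (s : R) : `|s| = 1 ->
  (s * m%:R) ^+ n * phi (s * m%:R) @[m --> \oo] --> (0 : R).
Proof.
move=> s1; have [K K0 HK] := pow_normal_pdf_le n.+1.
apply/cvgr0Pnorm_lt => e e0.
near=> m.
have m0 : (0 : R) < m%:R by rewrite ltr0n; near: m; exact: nbhs_infty_gt.
rewrite normrM normrX (ger0_norm (phi_ge0 _)) normrM s1 mul1r (ger0_norm (ltW m0)).
rewrite -(ltr_pM2l m0) mulrA -exprS.
have := HK (s * m%:R); rewrite normrM s1 mul1r (ger0_norm (ltW m0)) -/phi => /le_lt_trans; apply.
apply: (@le_lt_trans _ _ (K * normal_peak 2)).
  by rewrite ler_wpM2l// normal_pdf_ub.
rewrite -ltr_pdivrMr//.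
rewrite (lt_le_trans (truncnS_gt _))// ler_nat.
near: m; exact: nbhs_infty_ge.
Unshelve. all: by end_near. Qed.

Let continuous_pow_phi n : continuous (fun x : R => x ^+ n * phi x).
Proof.
move=> x; apply: cvgM; first exact: exprn_continuous.
by apply: continuous_normal_pdf; rewrite oner_eq0.
Qed.

(** Integration by parts: the difference of the two integrands is the derivative of
    [x ^+ n.+1 * phi x], which vanishes at both ends. *)
Lemma normal_moment_rec n :
  \int[mu]_x (x ^+ n.+2 * normal_pdf 0 1 x) =
  n.+1%:R * \int[mu]_x (x ^+ n * normal_pdf 0 1 x).
Proof.
have i1 := integrable_pow_normal_pdf n.
have i2 := integrable_pow_normal_pdf n.+2.
have i3 := integrableZl measurableT n.+1%:R i1.
apply/esym/eqP; rewrite -subr_eq0 -RintegralZl// -RintegralB//.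
rewrite /Rintegral (integral_derive_eq0 (is_derive_pow_phi n))//.
- move=> x; apply: cvgB; last exact: continuous_pow_phi.
  by apply: cvgMr; exact: continuous_pow_phi.
- exact: (integrableB measurableT i3 i2).
- have := @cvg_pow_phi n.+1 1 (normr1 _).
  by under eq_fun do rewrite mul1r.
- have := @cvg_pow_phi n.+1 (-1) (normrN1 _).
  by under eq_fun do rewrite mulN1r.
Qed.

Lemma normal_moment0 : \int[mu]_x (x ^+ 0 * normal_pdf 0 1 x) = 1.
Proof.
under eq_Rintegral do rewrite expr0 mul1r.
by rewrite /Rintegral integral_normal_pdf.
Qed.

Lemma normal_moment1 : \int[mu]_x (x ^+ 1 * normal_pdf 0 1 x) = 0.
Proof.
have i1 := integrable_pow_normal_pdf 1.
apply: oppr_inj; rewrite oppr0 -mulN1r -RintegralZl//.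
(* The integrand is, up to sign, the derivative of the density itself. *)
have d x : is_derive x (1 : R) phi (-1 * (x ^+ 1 * phi x)).
  by rewrite expr1 mulrA mulN1r; exact: is_derive_phi.
rewrite /Rintegral (integral_derive_eq0 d)//.
- by move=> x; apply: cvgMr; exact: continuous_pow_phi.
- exact: (integrableZl measurableT (-1) i1).
- have := @cvg_pow_phi 0 1 (normr1 _).
  by under eq_fun do rewrite mul1r expr0 mul1r.
- have := @cvg_pow_phi 0 (-1) (normrN1 _).
  by under eq_fun do rewrite mulN1r expr0 mul1r.
Qed.

End normal_moments.

Section entry_moments.
Context (R : realType) (dT : measure_display) (T : measurableType dT).
Context (P : probability T R) (X : T -> R).

Let one_ge0 (w : T) : 0 <= (fun=> 1 : R) w. Proof. by []. Qed.

Section normal.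
Hypothesis nX : std_normal_rv P X.

Let mX : measurable_fun setT (X : T -> measurableTypeR R). Proof. by case: nX. Qed.

(* normal_prob and lebesgue_measure are canonically measures on measurableTypeR R
   only, which is convertible to R. *)
Let mu : {measure set (measurableTypeR R) -> \bar R} := @lebesgue_measure R.
Let nu : {measure set (measurableTypeR R) -> \bar R} := normal_prob 0 1.

Let lawE (B : set (measurableTypeR R)) : measurable B ->
  nu B = (\int[P]_(w in X @^-1` B) (1 : R)%:E)%E.
Proof.
move=> mB; rewrite integral_cst ?mul1e//; first exact/esym/nX.2.
by rewrite -(setTI (_ @^-1` _)); exact: mX.
Qed.

Let densE (B : set (measurableTypeR R)) : measurable B -> nu B =
  (\int[mu]_(x in id @^-1` B) (normal_pdf 0 1 x)%:E)%E.
Proof. by []. Qed.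

Let mpow n : measurable_fun setT (fun x : measurableTypeR R => (x : R) ^+ n).
Proof. exact: exprn_measurable. Qed.

Let mid : measurable_fun setT (@id (measurableTypeR R)). Proof. exact: measurable_id. Qed.

Let mone : measurable_fun setT (fun _ : T => 1 : R). Proof. exact: measurable_cst. Qed.

Let mphi : measurable_fun setT (normal_pdf (0 : R) 1 : measurableTypeR R -> R).
Proof. exact: measurable_normal_pdf. Qed.

Let phi0 (x : R) : 0 <= normal_pdf 0 1 x. Proof. exact: normal_pdf_ge0. Qed.

(** Two changes of variables: from Lebesgue measure to the normal law through the density, then from
    the law to [P] through [X]. *)
Lemma std_normal_integrable n : P.-integrable setT (fun w => (X w ^+ n)%:E).
Proof.
have := @integrable_pow_normal_pdf R n.
move/(integrable_weighted mid mphi phi0 densE (mpow n)).2.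
move/(integrable_weighted mX mone one_ge0 lawE (mpow n)).1.
by under eq_fun do rewrite mulr1.
Qed.

Lemma std_normal_moment n :
  \int[P]_w (X w ^+ n) = \int[lebesgue_measure]_x (x ^+ n * normal_pdf 0 1 x).
Proof.
rewrite /Rintegral -(integral_weighted mid mphi phi0 densE (mpow n)).
rewrite (integral_weighted mX mone one_ge0 lawE (mpow n)).
by under [in RHS]eq_integral do rewrite mulr1.
Qed.

Lemma std_normal_E1 : \int[P]_w (X w ^+ 1) = 0.
Proof. by rewrite std_normal_moment normal_moment1. Qed.

Lemma std_normal_E2 : \int[P]_w (X w ^+ 2) = 1.
Proof. by rewrite std_normal_moment normal_moment_rec normal_moment0 mulr1. Qed.

Lemma std_normal_E3 : \int[P]_w (X w ^+ 3) = 0.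
Proof. by rewrite std_normal_moment normal_moment_rec normal_moment1 mulr0. Qed.

Lemma std_normal_E4 : \int[P]_w (X w ^+ 4) = 3.
Proof. by rewrite std_normal_moment !normal_moment_rec normal_moment0 !mulr1. Qed.

Lemma std_normal_small_ball (t : R) : 0 <= t ->
  (P [set w | `|X w| < t]%R <= t%:E)%E.
Proof.
move=> t0; have -> : [set w | `|X w| < t] = X @^-1` `]-t, t[%classic.
  by apply/seteqP; split => w /=; rewrite in_itv/= ltr_norml.
rewrite (nX.2 _ (measurable_itv _)) /normal_prob.
pose A := `]-t, t[%classic.
have h : (\int[mu]_(x in A) (normal_pdf 0 1 x)%:E <=
    \int[mu]_(x in A) (normal_peak (1 : R))%:E)%E.
  have mA : measurable (A : set (measurableTypeR R)) by exact: measurable_itv.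
  apply: ge0_le_integral => //.
  - by move=> x _; rewrite lee_fin.
  - by apply/measurable_EFinP; exact: measurable_funTS.
  - by move=> x _; rewrite lee_fin normal_pdf_ub// oner_eq0.
apply: le_trans h _.
rewrite integral_cst//; last exact: measurable_itv.
have muA : mu A = _ := lebesgue_measure_itv `]-t, t[%R; rewrite muA/= lte_fin.
case: ifPn => [_|_]; last by rewrite mule0 lee_fin.
rewrite -EFinB -EFinM lee_fin opprK.
(* The peak 1/sqrt(2 pi) is at most 1/2 because pi >= 2; multiplied by the length 2t it gives t. *)
have : normal_peak (1 : R) <= 2^-1.
  rewrite /normal_peak lef_pV2 ?posrE// ?sqrtr_gt0.
    rewrite -[leLHS]ger0_norm// -sqrtr_sqr ler_sqrt.
      by rewrite expr1n mul1r -mulr_natr; have := pi_ge2 R; nra.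
    by rewrite pmulrn_lge0// mulr_ge0// pi_ge0.
  by rewrite pmulrn_lgt0// mulr_gt0 ?pi_gt0// expr1n.
by have := normal_peak_ge0 (1 : R); nra.
Qed.

End normal.

Section rademacher.
Hypothesis rX : rademacher_rv P X.

Let mX : measurable_fun setT X. Proof. by case: rX. Qed.

Let mX1 r : measurable (X @^-1` [set r]).
Proof. by rewrite -(setTI (_ @^-1` _)); exact: mX. Qed.

(** [rademacher_rv] fixes only the masses of the two points, so [X] may take other values on a null
    set. This almost-everywhere version of the power is computable from those masses. *)
Let Xpow n w : R := \1_(X @^-1` [set 1]) w + (-1) ^+ n * \1_(X @^-1` [set -1]) w.

Let mXpow n : measurable_fun setT (Xpow n).
Proof.
apply: measurable_funD; first exact: measurable_indic.
by apply: measurable_funM => //; exact: measurable_indic.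
Qed.

Let mXn n : measurable_fun setT (fun w => X w ^+ n).
Proof. by apply: measurable_funX; exact: mX. Qed.

Let iXpow n : P.-integrable setT (EFin \o Xpow n).
Proof.
have i1 := integrable_indic P (mX1 1).
have i2 := integrableZl measurableT ((-1) ^+ n) (integrable_indic P (mX1 (-1))).
exact: (integrableD measurableT i1 i2).
Qed.

Let oneN1 : (1 : R) != -1.
Proof. by rewrite -subr_eq0 opprK gt_eqF// addr_gt0. Qed.

Let XpowE n : ae_eq P setT (fun w => (X w ^+ n)%:E) (EFin \o Xpow n).
Proof.
exists (~` (X @^-1` [set 1] `|` X @^-1` [set -1])); split.
- by apply: measurableC; exact: measurableU.
- have disj : [disjoint X @^-1` [set 1] & X @^-1` [set -1]].
    apply/disj_setPS => w /= [-> /eqP].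
    by rewrite (negbTE oneN1).
  rewrite /= probability_setC; last exact: measurableU.
  rewrite measureU//; last exact/disj_set2P.
  rewrite /= rX.2.1 rX.2.2 -EFinD (_ : 1 / 2 + 1 / 2 = 1 :> R); last by field.
  by rewrite subrr.
- move=> w; apply: contra_not => /= -[] Xw _; rewrite /Xpow Xw !indicE /=.
    rewrite mem_set// memNset ?mulr0 ?addr0 ?expr1n//=.
    by rewrite Xw => /eqP; rewrite (negbTE oneN1).
  rewrite memNset ?mem_set// ?mulr1 ?add0r//=.
  by rewrite Xw => /eqP; rewrite eq_sym (negbTE oneN1).
Qed.

Lemma rademacher_integrable n : P.-integrable setT (fun w => (X w ^+ n)%:E).
Proof.
have mE : measurable_fun setT (fun w => (X w ^+ n)%:E) by exact/measurable_EFinP.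
have /integrableP[_ iX] := iXpow n.
apply/integrableP; split => //.
rewrite (ae_eq_integral (fun w => `|(Xpow n w)%:E|)%E)//; first last.
- by have := XpowE n; apply: filterS => w H D; rewrite (H D).
- by apply: measurableT_comp => //; exact/measurable_EFinP.
- exact: measurableT_comp.
Qed.

Lemma rademacher_moment n : \int[P]_w (X w ^+ n) = (1 + (-1) ^+ n) / 2.
Proof.
rewrite /Rintegral (ae_eq_integral (EFin \o Xpow n))//; last 2 first.
  exact/measurable_EFinP.
  exact/measurable_EFinP.
have i1 := integrable_indic P (mX1 1).
have i2 := integrable_indic P (mX1 (-1)).
rewrite -/(Rintegral P setT (Xpow n)) RintegralD//; last first.
  exact: (integrableZl measurableT ((-1) ^+ n) i2).
rewrite RintegralZl// /Rintegral !integral_indic// !setIT/= rX.2.1 rX.2.2/=.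
by field.
Qed.

End rademacher.

Section entry.
Variable b : bool.
Hypothesis eX : entry_law P b X.

Lemma entry_law_measurable : measurable_fun setT X.
Proof. by case: b eX => -[]. Qed.

Lemma entry_law_integrable n : P.-integrable setT (fun w => (X w ^+ n)%:E).
Proof.
by case: b eX => h; [exact: (rademacher_integrable h)|exact: (std_normal_integrable h)].
Qed.

Lemma entry_law_E1 : \int[P]_w (X w ^+ 1) = 0.
Proof.
case: b eX => h; last exact: (std_normal_E1 h).
by rewrite (rademacher_moment h) expr1 subrr mul0r.
Qed.

Lemma entry_law_E2 : \int[P]_w (X w ^+ 2) = 1.
Proof.
case: b eX => h; last exact: (std_normal_E2 h).
by rewrite (rademacher_moment h) sqrrN expr1n; field.
Qed.

Lemma entry_law_E4 : \int[P]_w (X w ^+ 4) <= 3.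
Proof.
case: b eX => h; last by rewrite (std_normal_E4 h).
rewrite (rademacher_moment h) -signr_odd/= expr0; lra.
Qed.

End entry.

End entry_moments.

(** * Moments of the quadratic form *)

Section kronecker_moments.
Context (R : realType) (dT : measure_display) (T : measurableType dT).
Context (P : probability T R) (I : finType) (X : I -> T -> R).
Hypothesis mX : forall i, measurable_fun setT (X i).
Hypothesis indep : mutually_independent P X.
Hypothesis iX : forall i n, P.-integrable setT (fun w => (X i w ^+ n)%:E).

Local Notation "''E' f" := (Rintegral P setT f) (at level 10, f at level 8).
Local Notation poly_in := (poly_in X).

Let EM := E_polyM mX indep iX.
Let ED := E_polyD mX indep iX.
Let EB := E_polyB mX indep iX.
Let EZ := E_polyZ mX indep iX.
Let Esum := E_poly_sum mX indep iX.
Let Eprod := E_poly_prod mX indep iX.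

(** The variables of g and x are located in an abstract family by [gi] and [xi], so that the same
    lemmas serve the single query of part (i) and each of the [l] queries of part (ii). *)
Variables (d k : nat) (gi : Index d k -> I) (xi : 'I_k -> 'I_d -> I).
Hypothesis gi_inj : injective gi.
Hypothesis xi_inj : forall i a j b, xi i a = xi j b -> i = j /\ a = b.
Hypothesis gi_neq_xi : forall J i a, gi J != xi i a.
Hypothesis g1 : forall J, 'E (fun w => X (gi J) w ^+ 1) = 0.
Hypothesis g2 : forall J, 'E (fun w => X (gi J) w ^+ 2) = 1.
Hypothesis g3 : forall J, 'E (fun w => X (gi J) w ^+ 3) = 0.
Hypothesis g4 : forall J, 'E (fun w => X (gi J) w ^+ 4) = 3.
Hypothesis x1 : forall i a, 'E (fun w => X (xi i a) w ^+ 1) = 0.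
Hypothesis x2 : forall i a, 'E (fun w => X (xi i a) w ^+ 2) = 1.
Hypothesis x4 : forall i a, 'E (fun w => X (xi i a) w ^+ 4) <= 3.

Let g J w := X (gi J) w.
Let x J w := kron (fun i a => X (xi i a) w) J.
Let q w := qform (gram (g^~ w)) (x^~ w).
Let tr w := trace (gram (g^~ w)).

Let G : {set I} := [set gi J | J in Index d k]%SET.
Let Bx i : {set I} := [set xi i a | a in 'I_d]%SET.
Let Sx : {set I} := (\bigcup_i Bx i)%SET.

Lemma poly_in_g J : poly_in G (g J).
Proof. by apply: poly_in_var; apply: imset_f. Qed.

Lemma poly_in_entry i a : poly_in (Bx i) (X (xi i a)).
Proof. by apply: poly_in_var; apply: imset_f. Qed.

Let Bx_sub i : Bx i \subset Sx. Proof. exact: finset.bigcup_sup. Qed.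

Lemma poly_in_x J : poly_in Sx (x J).
Proof.
apply: poly_in_prod => i; exact: sub_poly_in (Bx_sub i) (poly_in_entry i (J i)).
Qed.

Let Bx_disjoint i j : i != j -> [disjoint Bx i & Bx j]%B.
Proof.
move=> ij; rewrite -finset.setI_eq0; apply/eqP/finset.setP => s; rewrite !inE.
apply/negbTE/negP => /andP[/imsetP[a _ ->] /imsetP[b _ /xi_inj[]]].
by move=> eij; rewrite eij eqxx in ij.
Qed.

Let G_Sx : [disjoint G & Sx]%B.
Proof.
rewrite -finset.setI_eq0; apply/eqP/finset.setP => s; rewrite !inE.
apply/negbTE/negP => /andP[/imsetP[J _ ->] /finset.bigcupP[i _ /imsetP[a _ e]]].
by have := gi_neq_xi J i a; rewrite e eqxx.
Qed.

Let disj1 (s s' : I) : s != s' -> [disjoint [set s]%SET & [set s']%SET]%B.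
Proof. by move=> ss'; rewrite disjoints1 finset.in_set1. Qed.

Let poly1 (s : I) n : poly_in [set s]%SET (fun w => X s w ^+ n).
Proof. by apply: poly_inX; apply: poly_in_var; rewrite finset.in_set1. Qed.

Lemma E_entry_mul i a b :
  'E (fun w => X (xi i a) w * X (xi i b) w) = (a == b)%:R.
Proof.
have [<-|ab] := eqVneq a b.
  by under eq_Rintegral do rewrite -expr2; rewrite x2.
have ab' : xi i a != xi i b by apply: contraNneq ab => /xi_inj[_ ->].
have := EM (disj1 ab') (poly1 _ 1) (poly1 _ 1).
rewrite !x1 mul0r => E0; rewrite -[RHS]E0.
by apply: eq_Rintegral => w _; rewrite !expr1.
Qed.

(** Isotropy of x: the expectation factors over the k modes, and distinct multi-indices differ in
    some mode, whose factor vanishes. *)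
Lemma E_kron_mul J K : 'E (fun w => x J w * x K w) = (J == K)%:R.
Proof.
transitivity ('E (fun w => \prod_i (X (xi i (J i)) w * X (xi i (K i)) w))).
  by apply: eq_Rintegral => w _; rewrite big_split.
rewrite (Eprod Bx_disjoint (F := fun i w => X (xi i (J i)) w * X (xi i (K i)) w)).
  under eq_bigr do rewrite E_entry_mul.
  have [->|JK] := eqVneq J K; first by rewrite big1// => i _; rewrite eqxx.
  have /existsP[i Ji] : [exists i, J i != K i].
    apply: contraNT JK; rewrite negb_exists => /forallP JK.
    by apply/eqP/ffunP => i; apply/eqP; have := JK i; rewrite negbK.
  by rewrite (bigD1 i)//= (negbTE Ji) mul0r.
by move=> i; apply: poly_inM; exact: poly_in_entry.
Qed.

Let qE w : q w = \sum_J \sum_K (g J w * g K w) * (x J w * x K w).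
Proof.
rewrite /q /qform; apply: eq_bigr => J _; apply: eq_bigr => K _; rewrite /gram.
by ring.
Qed.

Let trE w : tr w = \sum_J g J w ^+ 2.
Proof. by []. Qed.

Lemma poly_in_tr : poly_in G tr.
Proof. by apply: poly_in_sum => J; apply: poly_inM; exact: poly_in_g. Qed.

Let poly_T S f (pf : poly_in S f) := poly_in_setT pf.
Let poly_gT J := poly_T (poly_in_g J).
Let poly_xT J := poly_T (poly_in_x J).

Lemma poly_in_qform : poly_in (G :|: Sx)%SET q.
Proof.
have pg J : poly_in (G :|: Sx)%SET (g J).
  by apply: sub_poly_in (poly_in_g J); exact: finset.subsetUl.
have px J : poly_in (G :|: Sx)%SET (x J).
  by apply: sub_poly_in (poly_in_x J); exact: finset.subsetUr.
apply: poly_in_sum => J; apply: poly_in_sum => K.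
by apply: poly_inM => //; apply: poly_inM => //; apply: poly_inM.
Qed.

(** Substitute for the conditional expectation of q given all variables outside x. The test
    polynomial [u] may involve g and also other queries; isotropy of x keeps only the diagonal
    terms. *)
Lemma E_mul_qform u : poly_in (~: Sx)%SET u ->
  'E (fun w => u w * q w) = 'E (fun w => u w * tr w).
Proof.
move=> pu; have puT := poly_T pu.
have GSx : G \subset (~: Sx)%SET by rewrite -finset.disjoints_subset.
have pg J : poly_in (~: Sx)%SET (g J) by exact: sub_poly_in GSx (poly_in_g J).
have dC : [disjoint (~: Sx)%SET & Sx]%B.
  by rewrite -finset.setI_eq0 finset.setIC finset.setICr.
under eq_Rintegral do rewrite qE mulr_sumr.
under [in RHS]eq_Rintegral do rewrite trE mulr_sumr.
rewrite (Esum (S := [set: I]%SET)); last first.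
  move=> J; apply: poly_inM => //; apply: poly_in_sum => K.
  by apply: poly_inM; apply: poly_inM.
rewrite (Esum (S := [set: I]%SET)); last first.
  by move=> J; apply: poly_inM => //; apply: poly_inX.
apply: eq_bigr => J _; under eq_Rintegral do rewrite mulr_sumr.
rewrite (Esum (S := [set: I]%SET)); last first.
  by move=> K; apply: poly_inM => //; apply: poly_inM; apply: poly_inM.
rewrite (bigD1 J)//= big1 ?addr0; last first.
  move=> K KJ; under eq_Rintegral do rewrite mulrA.
  rewrite (EM dC); first by rewrite E_kron_mul eq_sym (negbTE KJ) mulr0.
    by apply: poly_inM => //; apply: poly_inM.
  by apply: poly_inM; exact: poly_in_x.
under eq_Rintegral do rewrite mulrA -[g J _ * _]expr2.
rewrite (EM dC); first by rewrite E_kron_mul eqxx mulr1.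
  by apply: poly_inM => //; apply: poly_inX.
by apply: poly_inM; exact: poly_in_x.
Qed.

(** Partial sums of g . x and of |x|^2, together with the variables they involve: all of x, but only
    the coordinates of g listed in [s]. A new coordinate of g is thus independent of [Seen s]. *)
Let Lin (s : seq (Index d k)) w := \sum_(J <- s) g J w * x J w.
Let Sq (s : seq (Index d k)) w := \sum_(J <- s) x J w ^+ 2.
Let Seen (s : seq (Index d k)) : {set I} := (Sx :|: [set gi J | J in s])%SET.

Let poly_Sq s : poly_in Sx (Sq s).
Proof. by apply: poly_in_sum => J; apply: poly_inX; exact: poly_in_x. Qed.

Let poly_Lin s : poly_in (Seen s) (Lin s).
Proof.
rewrite /Lin; under eq_fun do rewrite big_seq big_mkcond/=.
apply: (poly_in_sum _ (F := fun J w => if J \in s then g J w * x J w else 0)) => J.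
case Js : (J \in s); last exact: poly_in_cst.
apply: poly_inM.
  by apply: poly_in_var; rewrite inE imset_f ?orbT.
by apply: sub_poly_in (poly_in_x J); exact: finset.subsetUl.
Qed.

Let E_new J s n h : J \notin s -> poly_in (Seen s) h ->
  'E (fun w => g J w ^+ n * h w) = 'E (fun w => g J w ^+ n) * 'E h.
Proof.
move=> Js ph; apply: (EM _ (poly1 (gi J) n) ph).
rewrite disjoints1 inE negb_or; apply/andP; split.
  have := disjointFr G_Sx (imset_f gi (isT : J \in Index d k)).
  by move=> ->.
by apply: contra Js => /imsetP[K Ks /gi_inj ->].
Qed.

Let poly_x_Seen J s : poly_in (Seen s) (x J).
Proof. by apply: sub_poly_in (poly_in_x J); exact: finset.subsetUl. Qed.

Let poly_LinT s := poly_T (poly_Lin s).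
Let poly_SqT s := poly_T (poly_Sq s).

(** The weight [z], a polynomial in x, is there for the fourth moment, whose expansion contains
    [Lin s w ^+ 2 * x J w ^+ 2]. *)
Let E_Lin2 s z : uniq s -> poly_in Sx z ->
  'E (fun w => Lin s w ^+ 2 * z w) = 'E (fun w => Sq s w * z w).
Proof.
elim: s z => [|J s IH] z /=.
  move=> _ _; apply: eq_Rintegral => w _.
  by rewrite /Lin /Sq !big_nil expr0n.
move=> /andP[Js us] pz; have pzT := poly_T pz.
have pzS : poly_in (Seen s) z by apply: sub_poly_in pz; exact: finset.subsetUl.
transitivity ('E (fun w => Lin s w ^+ 2 * z w +
    (g J w ^+ 1 * (2 * Lin s w * x J w * z w) + g J w ^+ 2 * (x J w ^+ 2 * z w)))).
  by apply: eq_Rintegral => w _; rewrite /Lin big_cons; ring.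
have p1 : poly_in (Seen s) (fun w => 2 * Lin s w * x J w * z w).
  apply: poly_inM => //; apply: poly_inM; last exact: poly_x_Seen.
  by apply: poly_inM; [exact: poly_in_cst|exact: poly_Lin].
have p2 : poly_in (Seen s) (fun w => x J w ^+ 2 * z w).
  by apply: poly_inM => //; apply: poly_inX; exact: poly_x_Seen.
have q1 := poly_inM (poly_inX 1 (poly_gT J)) (poly_T p1).
have q2 := poly_inM (poly_inX 2 (poly_gT J)) (poly_T p2).
rewrite (ED (poly_inM (poly_inX 2 (poly_LinT s)) pzT) (poly_inD q1 q2)) (ED q1 q2).
rewrite (E_new 1 Js p1) (E_new 2 Js p2) g1 g2 mul0r add0r mul1r IH//.
rewrite -(ED (poly_inM (poly_SqT s) pzT) (poly_T p2)).
by apply: eq_Rintegral => w _; rewrite /Sq big_cons; ring.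
Qed.

(* Adding one Gaussian coordinate at a time, its odd moments vanish and the even
   ones recombine into a square: this replaces Isserlis' formula. *)
Let E_Lin4 s : uniq s ->
  'E (fun w => Lin s w ^+ 4) = 3 * 'E (fun w => Sq s w ^+ 2).
Proof.
elim: s => [|J s IH] /=.
  move=> _; rewrite /Lin /Sq.
  under eq_Rintegral do rewrite big_nil expr0n/=.
  under [in RHS]eq_Rintegral do rewrite big_nil expr0n/=.
  by rewrite E_cst mulr0.
move=> /andP[Js us].
have pL := poly_Lin s; have px := poly_x_Seen J s.
have pc c : poly_in (Seen s) (fun=> c) by exact: poly_in_cst.
pose h1 w := 4 * (Lin s w ^+ 3 * x J w).
pose h2 w := 6 * (Lin s w ^+ 2 * x J w ^+ 2).
pose h3 w := 4 * (Lin s w * x J w ^+ 3).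
pose h4 w := x J w ^+ 4.
have p1 : poly_in (Seen s) h1.
  by apply: poly_inM => //; apply: poly_inM => //; exact: poly_inX.
have p2 : poly_in (Seen s) h2.
  by apply: poly_inM => //; apply: poly_inM; exact: poly_inX.
have p3 : poly_in (Seen s) h3.
  by apply: poly_inM => //; apply: poly_inM => //; exact: poly_inX.
have p4 : poly_in (Seen s) h4 by exact: poly_inX.
transitivity ('E (fun w => Lin s w ^+ 4 + (g J w ^+ 1 * h1 w +
    (g J w ^+ 2 * h2 w + (g J w ^+ 3 * h3 w + g J w ^+ 4 * h4 w))))).
  by apply: eq_Rintegral => w _; rewrite /h1 /h2 /h3 /h4 /Lin big_cons; ring.
have q1 := poly_inM (poly_inX 1 (poly_gT J)) (poly_T p1).
have q2 := poly_inM (poly_inX 2 (poly_gT J)) (poly_T p2).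
have q3 := poly_inM (poly_inX 3 (poly_gT J)) (poly_T p3).
have q4 := poly_inM (poly_inX 4 (poly_gT J)) (poly_T p4).
rewrite (ED (poly_inX 4 (poly_LinT s)) (poly_inD q1 (poly_inD q2 (poly_inD q3 q4)))).
rewrite (ED q1 (poly_inD q2 (poly_inD q3 q4))) (ED q2 (poly_inD q3 q4)) (ED q3 q4).
rewrite (E_new 1 Js p1) (E_new 2 Js p2) (E_new 3 Js p3) (E_new 4 Js p4).
rewrite g1 g2 g3 g4 !mul0r !add0r mul1r IH// /h2 /h4.
rewrite (EZ 6 (poly_T (poly_inM (poly_inX 2 pL) (poly_inX 2 px)))).
rewrite (E_Lin2 us (poly_inX 2 (poly_in_x J))).
have r1 := poly_inX 2 (poly_SqT s).
have r2 := poly_inM (poly_SqT s) (poly_inX 2 (poly_xT J)).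
have r3 := poly_inX 4 (poly_xT J).
(* The binomial coefficient 6 is 3 * 2 and the Gaussian fourth moment is 3, so 3 factors out and
   leaves the expansion of [(Sq s w + x J w ^+ 2) ^+ 2]. *)
transitivity (3 * ('E (fun w => Sq s w ^+ 2) + (2 * 'E (fun w => Sq s w * x J w ^+ 2) +
   'E (fun w => x J w ^+ 4)))); first by ring.
congr (3 * _); rewrite -(EZ 2 r2) -(ED (poly_inM (poly_in_cst _ _ 2) r2) r3).
rewrite -(ED r1 (poly_inD (poly_inM (poly_in_cst _ _ 2) r2) r3)).
by apply: eq_Rintegral => w _; rewrite /Sq big_cons; ring.
Qed.

(** Among the pairs of coordinates, d(d-1) distinct ones contribute 1 each and d equal ones at most
    3 each. *)
Let E_norm4 i : 'E (fun w => (\sum_a X (xi i a) w ^+ 2) ^+ 2) <= (d ^ 2 + 2 * d)%:R.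
Proof.
have pe a : poly_in (Bx i) (fun w => X (xi i a) w ^+ 2).
  by apply: poly_inX; exact: poly_in_entry.
under eq_Rintegral do rewrite expr2 mulr_suml.
rewrite (Esum (S := Bx i)); last first.
  by move=> a; apply: poly_inM => //; apply: poly_in_sum.
have -> : (d ^ 2 + 2 * d)%:R = \sum_(a < d) (d%:R + 2) :> R.
  by rewrite sumr_const card_ord -mulr_natr natrD natrX natrM; ring.
apply: ler_sum => a _; under eq_Rintegral do rewrite mulr_sumr.
rewrite (Esum (S := Bx i)); last by move=> b; apply: poly_inM.
have -> : d%:R + 2 = \sum_(b < d) (1 + 2 * (b == a)%:R) :> R.
  rewrite big_split/= sumr_const card_ord; congr (_ + _).
  by rewrite (bigD1 a)//= eqxx big1 ?addr0 ?mulr1// => b /negbTE ->; rewrite mulr0.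
apply: ler_sum => b _; have [->|ba] := eqVneq b a.
  under eq_Rintegral do rewrite -exprD; apply: le_trans (x4 i a) _.
  by rewrite mulr1; lra.
have ab' : xi i a != xi i b by apply: contraNneq ba => /xi_inj[_ ->].
by rewrite (EM (disj1 ab') (poly1 _ 2) (poly1 _ 2)) !x2 mulr0 addr0 mulr1.
Qed.

Lemma E_qform2_le : 'E (fun w => q w ^+ 2) <= 3 * (d ^ 2 + 2 * d)%:R ^+ k.
Proof.
pose s := index_enum (Index d k : finType).
have qL w : q w = Lin s w ^+ 2.
  rewrite qE expr2 mulr_suml; apply: eq_bigr => J _.
  by rewrite mulr_sumr; apply: eq_bigr => K _; ring.
(* The squared norm of a Kronecker product is the product of the squared norms, and these are
   independent. *)
have SL w : Sq s w = \prod_i \sum_a X (xi i a) w ^+ 2.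
  by rewrite bigA_distr_bigA; apply: eq_bigr => J _; rewrite /x /kron prodrXl.
under eq_Rintegral do rewrite qL -exprM.
rewrite (E_Lin4 (index_enum_uniq _)) ler_wpM2l//.
under eq_Rintegral do rewrite SL -prodrXl.
rewrite (Eprod Bx_disjoint (F := fun i w => (\sum_a X (xi i a) w ^+ 2) ^+ 2)); last first.
  move=> i; apply: poly_inX; apply: poly_in_sum => a; apply: poly_inX.
  exact: poly_in_entry.
rewrite -[leRHS](_ : \prod_(i < k) (d ^ 2 + 2 * d)%:R = _); last first.
  by rewrite prodr_const card_ord.
apply: ler_prod => i _; apply/andP; split => //.
by apply: Rintegral_ge0 => w _; exact: sqr_ge0.
Qed.

Let poly_qT := poly_T poly_in_qform.
Let poly_trT := poly_T poly_in_tr.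

Lemma E_mul_centered u : poly_in (~: Sx)%SET u ->
  'E (fun w => u w * (q w - tr w)) = 0.
Proof.
move=> pu; have puT := poly_T pu.
under eq_Rintegral do rewrite mulrBr.
by rewrite (EB (poly_inM puT poly_qT) (poly_inM puT poly_trT)) E_mul_qform// subrr.
Qed.

(** (q - tr)^2 = q^2 - tr^2 - 2 tr (q - tr); the last term has mean zero because [tr] does not
    involve x, and - tr^2 is dropped. *)
Lemma E_centered2_le : 'E (fun w => (q w - tr w) ^+ 2) <= 3 * (d ^ 2 + 2 * d)%:R ^+ k.
Proof.
apply: le_trans E_qform2_le.
have GSx : G \subset (~: Sx)%SET by rewrite -finset.disjoints_subset.
have ptr := sub_poly_in GSx poly_in_tr.
have pqt := poly_inM poly_trT (poly_inB poly_qT poly_trT).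
have q2 := poly_inX 2 poly_qT; have t2 := poly_inX 2 poly_trT.
have -> : 'E (fun w => (q w - tr w) ^+ 2) =
    'E (fun w => (q w ^+ 2 - tr w ^+ 2) - 2 * (tr w * (q w - tr w))).
  by apply: eq_Rintegral => w _; ring.
rewrite (EB (poly_inB q2 t2) (poly_inM (poly_in_cst _ _ 2) pqt)) (EZ 2 pqt).
rewrite (E_mul_centered ptr) mulr0 subr0 (EB q2 t2) lerBlDr lerDl.
by apply: Rintegral_ge0 => w _; exact: sqr_ge0.
Qed.

(** * The quadratic form at a fixed value of g *)

Let qc (gamma : Index d k -> R) w := qform (gram gamma) (x^~ w).
Let Pair := (Index d k * Index d k)%type.
Let xx (p : Pair) w := x p.1 w * x p.2 w.
Let gg (gamma : Index d k -> R) (p : Pair) := gamma p.1 * gamma p.2.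

(* The conditional expectation of (x^T gamma gamma^T x)^2, expanded so that it is
   visibly a polynomial, hence measurable, in gamma. *)
Definition cond_second_moment (gamma : Index d k -> R) : R :=
  \sum_(p : Pair) \sum_(r : Pair) gg gamma p * gg gamma r * 'E (fun w => xx p w * xx r w).

Let poly_xx p : poly_in Sx (xx p).
Proof. by apply: poly_inM; exact: poly_in_x. Qed.

Let qcE gamma w : qc gamma w = \sum_(p : Pair) gg gamma p * xx p w.
Proof.
rewrite /qc /qform pair_bigA; apply: eq_bigr => p _.
by rewrite /gram /gg /xx; ring.
Qed.

Let qc2E gamma w : qc gamma w ^+ 2 =
  \sum_(p : Pair) \sum_(r : Pair) gg gamma p * gg gamma r * (xx p w * xx r w).
Proof.
rewrite expr2 qcE mulr_suml; apply: eq_bigr => p _.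
by rewrite mulr_sumr; apply: eq_bigr => r _; ring.
Qed.

Let poly_qc gamma : poly_in Sx (qc gamma).
Proof.
rewrite (_ : qc gamma = fun w => \sum_(p : Pair) gg gamma p * xx p w); last first.
  by apply/funext => w; rewrite qcE.
by apply: poly_in_sum => p; apply: poly_inM; [exact: poly_in_cst|exact: poly_xx].
Qed.

Let E_qc gamma : 'E (qc gamma) = trace (gram gamma).
Proof.
transitivity ('E (fun w => \sum_(p : Pair) gg gamma p * xx p w)).
  by apply: eq_Rintegral => w _; exact: qcE.
rewrite (Esum (S := Sx)); last first.
  by move=> p; apply: poly_inM; [exact: poly_in_cst|exact: poly_xx].
under eq_bigr do rewrite (EZ _ (poly_xx _)) E_kron_mul.
rewrite -(pair_bigA _ (fun J K => gamma J * gamma K * (J == K)%:R)) /=.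
apply: eq_bigr => J _; rewrite (bigD1 J)//= eqxx mulr1 big1 ?addr0// => K KJ.
by rewrite eq_sym (negbTE KJ) mulr0.
Qed.

Let E_qc2 gamma : 'E (fun w => qc gamma w ^+ 2) = cond_second_moment gamma.
Proof.
have pxx p r c : poly_in Sx (fun w => c * (xx p w * xx r w)).
  by apply: poly_inM; [exact: poly_in_cst|apply: poly_inM; exact: poly_xx].
under eq_Rintegral do rewrite qc2E.
rewrite (Esum (S := Sx)); last by move=> p; apply: poly_in_sum => r; exact: pxx.
apply: eq_bigr => p _; rewrite (Esum (S := Sx)); last by move=> r; exact: pxx.
apply: eq_bigr => r _; rewrite (EZ _ (S := Sx))//.
by apply: poly_inM; exact: poly_xx.
Qed.

Lemma cond_second_moment_ge0 gamma : 0 <= cond_second_moment gamma.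
Proof. by rewrite -E_qc2; apply: Rintegral_ge0 => w _; exact: sqr_ge0. Qed.

Let poly_gg p : poly_in G (fun w => gg (g^~ w) p).
Proof. by apply: poly_inM; exact: poly_in_g. Qed.

Lemma poly_in_cond_second_moment :
  poly_in G (fun w => cond_second_moment (g^~ w)).
Proof.
apply: poly_in_sum => p; apply: poly_in_sum => r.
by apply: poly_inM; [apply: poly_inM; exact: poly_gg|exact: poly_in_cst].
Qed.

(** The tower property: in each term of the expansion the g-part and the x-part are independent. *)
Lemma E_cond_second_moment :
  'E (fun w => cond_second_moment (g^~ w)) = 'E (fun w => q w ^+ 2).
Proof.
have pgg p r := poly_inM (poly_gg p) (poly_gg r).
have pxx p r := poly_inM (poly_xx p) (poly_xx r).
have pggT p r := poly_T (pgg p r); have pxxT p r := poly_T (pxx p r).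
have pG p r c : poly_in G (fun w => gg (g^~ w) p * gg (g^~ w) r * c).
  by apply: poly_inM => //; exact: poly_in_cst.
under [in RHS]eq_Rintegral do rewrite -/(qc (g^~ _) _) qc2E.
rewrite (Esum (S := G)); last by move=> p; apply: poly_in_sum => r; exact: pG.
rewrite (Esum (S := [set: I]%SET)); last first.
  by move=> p; apply: poly_in_sum => r; exact: poly_inM.
apply: eq_bigr => p _; rewrite (Esum (S := G)); last by move=> r; exact: pG.
rewrite (Esum (S := [set: I]%SET)); last by move=> r; exact: poly_inM.
apply: eq_bigr => r _; rewrite (EM G_Sx (pgg p r) (pxx p r)).
under eq_Rintegral do rewrite mulrC.
by rewrite (EZ _ (pgg p r)) mulrC.
Qed.

(** The equality serves twice: it bounds the variance by the second moment, and it makes the event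
    of part (i) measurable, its right side being polynomial in [gamma]. *)
Lemma cond_varE gamma : cond_var P (fun i a => X (xi i a)) gamma =
  (cond_second_moment gamma - trace (gram gamma) ^+ 2)%:E.
Proof.
rewrite /cond_var -[X in variance P X]/(qc gamma).
have i1 := poly_in_integrable mX indep iX (poly_qc gamma).
have i2 := poly_in_integrable mX indep iX (poly_inX 2 (poly_qc gamma)).
have l1 : qc gamma \in Lfun P 1 by exact/Lfun1_integrable.
have l2 : qc gamma * qc gamma \in Lfun P 1.
  by apply/Lfun1_integrable; apply: eq_integrable i2.
rewrite /variance covarianceE// unlock.
have -> : (\int[P]_w ((qc gamma * qc gamma) w)%:E = (cond_second_moment gamma)%:E)%E.
  by rewrite -E_qc2 /Rintegral fineK//; exact: integrable_fin_num i2.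
have -> : (\int[P]_w (qc gamma w)%:E = (trace (gram gamma))%:E)%E.
  by rewrite -E_qc /Rintegral fineK//; exact: integrable_fin_num i1.
by rewrite -EFinM -EFinB expr2.
Qed.

End kronecker_moments.

(** * Tail bounds *)

Section tail_bounds.
Context (R : realType) (dT : measure_display) (T : measurableType dT).
Context (P : probability T R).

Lemma measurable_le_fun (f h : T -> R) : measurable_fun setT f ->
  measurable_fun setT h -> measurable [set w | f w <= h w].
Proof.
move=> mf mh; rewrite -(setTI [set _ | _]).
by apply: (measurable_fun_le _ mf mh).
Qed.

Lemma measurable_lt_fun (f h : T -> R) : measurable_fun setT f ->
  measurable_fun setT h -> measurable [set w | f w < h w].
Proof.
move=> mf mh; rewrite (_ : [set _ | _] = ~` [set w | h w <= f w]).
  by apply: measurableC; exact: measurable_le_fun.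
by apply/seteqP; split => w /=; rewrite ltNge => /negP.
Qed.

Lemma markov_inequality (f : T -> R) (a b : R) : 0 < a ->
  P.-integrable setT (EFin \o f) -> (forall w, 0 <= f w) ->
  \int[P]_w f w <= a * b -> (P [set w | (a <= f w)%R] <= b%:E)%E.
Proof.
move=> a0 intf f0 fab; have mf := measurable_int P intf.
have mfR : measurable_fun setT f by exact/measurable_EFinP.
have mA : measurable [set w | a <= f w] by exact: measurable_le_fun.
rewrite -(@lee_pmul2l _ a%:E) ?lte_fin// -EFinM.
apply: (@le_trans _ _ (\int[P]_w (f w)%:E)%E); last first.
  by rewrite -[leLHS]fineK ?lee_fin//; exact: integrable_fin_num.
have -> : (a%:E * P [set w | (a <= f w)%R] =
    \int[P]_w (a%:E * (\1_[set w | (a <= f w)%R] w)%:E))%E.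
  rewrite ge0_integralZl//; first by rewrite integral_indic// setIT.
  - by apply/measurable_EFinP; exact: measurable_indic.
  - by rewrite lee_fin ltW.
apply: ge0_le_integral => //.
- by move=> w _; rewrite -EFinM lee_fin mulr_ge0// ltW.
- apply: measurable_funeM; apply/measurable_EFinP; exact: measurable_indic.
- move=> w _; rewrite -EFinM lee_fin indicE.
  by have [/set_mem|_] := boolP (w \in _); rewrite ?mulr1 ?mulr0.
Qed.

Lemma probability_ge_complement (A B C : set T) (b c : R) :
  measurable A -> measurable B -> measurable C -> ~` A `<=` B `|` C ->
  (P B <= b%:E)%E -> (P C <= c%:E)%E -> ((1 - (b + c))%:E <= P A)%E.
Proof.
move=> mA mB mC ABC Pb Pc.
have PA : (P (~` A) <= (b + c)%:E)%E.
  apply: (@le_trans _ _ (P (B `|` C))).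
    by apply: le_measure => //; rewrite inE//; [exact: measurableC|exact: measurableU].
  by apply: (le_trans (measureU2 P mB mC)); rewrite EFinD leeD.
move: PA; rewrite probability_setC//.
rewrite -(@fineK _ (P A)) ?fin_num_measure// -EFinB !lee_fin => h.
by rewrite lerBlDr addrC -lerBlDr.
Qed.

(* Markov's inequality for the number of J with |g J| < t: with probability at
   least 1 - 2t half of the coordinates satisfy |g J| >= t, uniformly in #|N|. *)
Lemma normal_norm2_small_ball (N : finType) (g : N -> T -> R) (t : R) :
  (0 < #|N|)%N -> 0 < t -> (forall J, std_normal_rv P (g J)) ->
  (P [set w | \sum_J g J w ^+ 2 < t ^+ 2 * #|N|%:R / 2]%R <= (2 * t)%:E)%E.
Proof.
move=> N0 t0 ng.
have mg J : measurable_fun setT (g J) by case: (ng J).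
pose A J := [set w | `|g J w| < t].
have mA J : measurable (A J).
  by apply: measurable_lt_fun => //; exact: measurableT_comp.
pose c w : R := \sum_J \1_(A J) w.
have iA J : P.-integrable setT (EFin \o (\1_(A J) : T -> R)) by exact: integrable_indic.
have ic : P.-integrable setT (EFin \o c).
  apply: (@eq_integrable _ _ _ _ _ measurableT (fun w => \sum_J (\1_(A J) w)%:E)%E).
    by move=> w _; rewrite /= sumEFin.
  by apply: integrable_sum => // J _; exact: iA.
have c0 w : 0 <= c w by apply: sumr_ge0.
have Nt : 0 < #|N|%:R / 2 :> R by rewrite divr_gt0// ltr0n.
have Ec : \int[P]_w c w <= #|N|%:R / 2 * (2 * t).
  rewrite Rintegral_sum//.
  have -> : #|N|%:R / 2 * (2 * t) = \sum_(J : N) t.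
    by rewrite sumr_const -mulr_natl; field.
  apply: ler_sum => J _; rewrite /Rintegral integral_indic// setIT.
  rewrite -lee_fin fineK ?fin_num_measure//.
  by apply: std_normal_small_ball => //; exact: ltW.
apply: le_trans (markov_inequality Nt ic c0 Ec).
apply: le_measure; rewrite ?inE.
- have ms : measurable_fun setT (fun w => \sum_J g J w ^+ 2).
    by apply: measurable_sum => J; exact: measurable_funX.
  exact: measurable_lt_fun.
- apply: measurable_le_fun => //.
  by apply: measurable_sum => J; exact: measurable_indic.
- move=> w /= sw.
  (* Each coordinate outside its [A J] contributes at least [t ^+ 2]. If fewer than half were small,
     the sum would exceed the threshold. *)
  have H : t ^+ 2 * (#|N|%:R - c w) <= \sum_J g J w ^+ 2.
    have -> : #|N|%:R - c w = \sum_(J : N) (1 - \1_(A J) w).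
      by rewrite sumrB sumr_const.
    rewrite mulr_sumr; apply: ler_sum => J _; rewrite indicE.
    have [|/negP] := boolP (w \in A J); first by rewrite subrr mulr0 sqr_ge0.
    rewrite inE /A/= => /negP; rewrite -leNgt subr0 mulr1 => tg.
    by rewrite -[leRHS]real_normK ?num_real// ler_sqr ?nnegrE// ltW.
  rewrite leNgt; apply/negP => cw.
  have t2 : 0 < t ^+ 2 by rewrite exprn_gt0.
  by nra.
Qed.

End tail_bounds.

(** * Variance and error of the estimator *)

Section variance_bound.
Context (R : realType) (d k : nat).
Hypothesis d0 : (0 < d)%N.

Let dR0 : 0 < d%:R :> R. Proof. by rewrite ltr0n. Qed.

Lemma rate_gt0 : 0 < (2 + d%:R^-1) ^+ k :> R.
Proof. by rewrite exprn_gt0// addr_gt0// invr_gt0. Qed.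

(** For each factor, d^2 (2 + 1/d) = 2d^2 + d exceeds d^2 + 2d by d(d - 1) >= 0. *)
Lemma fourth_moment_rate_le :
  (d ^ 2 + 2 * d)%:R ^+ k <= (d ^ k)%:R ^+ 2 * (2 + d%:R^-1) ^+ k :> R.
Proof.
have -> : (d ^ k)%:R ^+ 2 = (d%:R ^+ 2) ^+ k :> R by rewrite natrX -!exprM mulnC.
rewrite -exprMn.
have d1 : 1 <= d%:R :> R by rewrite ler1n.
have r0 : 0 <= d%:R ^+ 2 * (2 + d%:R^-1) :> R.
  by rewrite mulr_ge0 ?sqr_ge0// addr_ge0// invr_ge0 ltW.
suff h : (d ^ 2 + 2 * d)%:R <= d%:R ^+ 2 * (2 + d%:R^-1) :> R.
  by apply: lerXn2r; rewrite ?nnegrE ?ler0n.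
rewrite natrD natrX natrM mulrDr.
have -> : d%:R ^+ 2 / d%:R = d%:R :> R by rewrite expr2 mulfK// gt_eqF.
by nra.
Qed.

Lemma card_Index : #|Index d k| = (d ^ k)%N.
Proof. by rewrite card_ffun !card_ord. Qed.

Lemma card_Index_gt0 : (0 < #|Index d k|)%N.
Proof. by rewrite card_Index expn_gt0 d0. Qed.

End variance_bound.

Lemma trace_small_ball (R : realType) (dT : measure_display)
    (T : measurableType dT) (P : probability T R) (d k : nat)
    (g : Index d k -> T -> R) : (0 < d)%N -> (forall J, std_normal_rv P (g J)) ->
  (P [set w | (trace (gram (g^~ w)) < (d ^ k)%:R / 512)%R] <= (1 / 8)%:E)%E.
Proof.
(* The choice t = 1/16 makes the failure probability 2t equal to 1/8 and the threshold factor t^2/2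
   equal to 1/512. *)
move=> d0 ng; have t0 : 0 < 1 / 16 :> R by rewrite divr_gt0.
have := normal_norm2_small_ball (card_Index_gt0 k d0) t0 ng.
rewrite card_Index (_ : 2 * (1 / 16) = 1 / 8 :> R); last by field.
by rewrite (_ : (1 / 16) ^+ 2 * (d ^ k)%:R / 2 = (d ^ k)%:R / 512 :> R)//; field.
Qed.

Lemma measurable_trace (R : realType) (dT : measure_display)
    (T : measurableType dT) (d k : nat) (g : Index d k -> T -> R) :
  (forall J, measurable_fun setT (g J)) ->
  measurable_fun setT (fun w => trace (gram (g^~ w))).
Proof. by move=> mg; apply: measurable_sum => J; exact: measurable_funM. Qed.

Section conditional_variance.
Context (R : realType) (d k : nat) (kind : 'I_k -> bool).
Context (dT : measure_display) (T : measurableType dT) (P : probability T R).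
Context (g : Index d k -> T -> R) (x : 'I_k -> 'I_d -> T -> R).
Hypothesis d0 : (0 < d)%N.
Hypothesis indep : mutually_independent P (joint1 g x).
Hypothesis ng : forall J, std_normal_rv P (g J).
Hypothesis ex : forall i a, entry_law P (kind i) (x i a).

Let X := joint1 g x.
Let xi (i : 'I_k) (a : 'I_d) : Index d k + 'I_k * 'I_d := inr (i, a).

Let mX s : measurable_fun setT (X s).
Proof. by case: s => [J|p]; [case: (ng J)|exact: (entry_law_measurable (ex _ _))]. Qed.

Let iX s n : P.-integrable setT (fun w => (X s w ^+ n)%:E).
Proof.
case: s => [J|p]; first exact: (std_normal_integrable (ng J)).
exact: (entry_law_integrable (ex p.1 p.2)).
Qed.

Let xi_inj i a j b : xi i a = xi j b -> i = j /\ a = b.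
Proof. by case=> -> ->. Qed.

Let tr w := trace (gram (g^~ w)).
Let F w := cond_second_moment P X xi (g^~ w).

Let V : R := (d ^ k)%:R ^+ 2 * (2 + d%:R^-1) ^+ k.

Let E_F_le : \int[P]_w F w <= 3 * V.
Proof.
rewrite /F (E_cond_second_moment mX indep iX (gi := inl) (xi := xi))//.
apply: (@le_trans _ _ (3 * (d ^ 2 + 2 * d)%:R ^+ k)); last first.
  by rewrite ler_wpM2l// fourth_moment_rate_le.
apply: (E_qform2_le mX indep iX (gi := inl) (xi := xi)) => //.
- by move=> J K [].
- by move=> J; exact: (std_normal_E1 (ng J)).
- by move=> J; exact: (std_normal_E2 (ng J)).
- by move=> J; exact: (std_normal_E3 (ng J)).
- by move=> J; exact: (std_normal_E4 (ng J)).
- by move=> i a; exact: (entry_law_E2 (ex i a)).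
- by move=> i a; exact: (entry_law_E4 (ex i a)).
Qed.

Lemma cond_var_bound : ((3 / 4)%:E <= P [set w |
  (cond_var P x (fun J => g J w) <=
     (24 * 512 ^+ 2 * (2 + d%:R^-1) ^+ k * trace (gram (fun J => g J w)) ^+ 2)%R%:E)%E])%E.
Proof.
have V0 : 0 < V.
  by rewrite mulr_gt0 ?rate_gt0// exprn_gt0// ltr0n expn_gt0 d0.
have pF := poly_in_cond_second_moment P X inl xi.
have iF := poly_in_integrable mX indep iX pF.
have mF : measurable_fun setT F by exact: (poly_in_measurable mX indep iX pF).
have mtr : measurable_fun setT tr by apply: measurable_trace => J; case: (ng J).
have F0 w : 0 <= F w by exact: cond_second_moment_ge0.
have -> : 3 / 4 = 1 - (1 / 8 + 1 / 8) :> R by field.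
have E w : cond_var P x (g^~ w) = (F w - tr w ^+ 2)%:E.
  apply: (cond_varE mX indep iX xi_inj).
  - by move=> i a; exact: (entry_law_E1 (ex i a)).
  - by move=> i a; exact: (entry_law_E2 (ex i a)).
(* 24 V is 8 times the mean bound 3 V. *)
have a0 : 0 < 24 * V by rewrite mulr_gt0.
have PF : (P [set w | (24 * V <= F w)%R] <= (1 / 8)%:E)%E.
  apply: (markov_inequality a0 iF F0).
  by apply: le_trans E_F_le _; rewrite le_eqVlt; apply/orP; left; apply/eqP; field.
apply: (probability_ge_complement _ _ _ _ PF (trace_small_ball d0 ng)).
- rewrite (_ : [set _ | _] = [set w | F w - tr w ^+ 2 <=
      24 * 512 ^+ 2 * (2 + d%:R^-1) ^+ k * tr w ^+ 2]); last first.
    by apply/seteqP; split => w /=; rewrite E lee_fin.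
  apply: measurable_le_fun.
    by apply: measurable_funB => //; exact: measurable_funX.
  by apply: measurable_funM => //; exact: measurable_funX.
- exact: measurable_le_fun.
- exact: measurable_lt_fun.
- move=> w /= Aw; apply: contrapT => /not_orP[/negP h1 /negP h2]; apply: Aw; move: h1 h2.
  rewrite E lee_fin -ltNge -leNgt -/(tr w) => FV trw.
  have r0 := rate_gt0 R d k.
  have D0 : 0 <= (d ^ k)%:R :> R by [].
  have D2 : (d ^ k)%:R ^+ 2 <= 512 ^+ 2 * tr w ^+ 2 by nra.
  have : V <= 512 ^+ 2 * tr w ^+ 2 * (2 + d%:R^-1) ^+ k by rewrite /V ler_wpM2r// ltW.
  by have := sqr_ge0 (tr w); nra.
Qed.

End conditional_variance.

Section hutchinson.
Context (R : realType) (d k l : nat) (kind : 'I_k -> bool).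
Context (dT : measure_display) (T : measurableType dT) (P : probability T R).
Context (g : Index d k -> T -> R) (x : 'I_l -> 'I_k -> 'I_d -> T -> R).
Hypothesis d0 : (0 < d)%N.
Hypothesis l0 : (0 < l)%N.
Hypothesis indep : mutually_independent P (jointl g x).
Hypothesis ng : forall J, std_normal_rv P (g J).
Hypothesis ex : forall j i a, entry_law P (kind i) (x j i a).

Let X := jointl g x.
Let xi j (i : 'I_k) (a : 'I_d) : Index d k + 'I_l * 'I_k * 'I_d := inr (j, i, a).

Let mX s : measurable_fun setT (X s).
Proof. by case: s => [J|p]; [case: (ng J)|exact: (entry_law_measurable (ex _ _ _))]. Qed.

Let iX s n : P.-integrable setT (fun w => (X s w ^+ n)%:E).
Proof.
case: s => [J|p]; first exact: (std_normal_integrable (ng J)).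
exact: (entry_law_integrable (ex p.1.1 p.1.2 p.2)).
Qed.

Let xi_inj j i a i' b : xi j i a = xi j i' b -> i = i' /\ a = b.
Proof. by case=> -> ->. Qed.

Let x1 j i a : \int[P]_w X (xi j i a) w ^+ 1 = 0.
Proof. exact: (entry_law_E1 (ex j i a)). Qed.

Let x2 j i a : \int[P]_w X (xi j i a) w ^+ 2 = 1.
Proof. exact: (entry_law_E2 (ex j i a)). Qed.

Let tr w := trace (gram (g^~ w)).
Let q j w := qform (gram (g^~ w)) (kron (fun i a => x j i a w)).
Let H w := hutch (gram (g^~ w)) (fun j i a => x j i a w).
Let D j w := q j w - tr w.

Let V : R := (d ^ k)%:R ^+ 2 * (2 + d%:R^-1) ^+ k.

Let poly_tr := poly_in_tr X (inl : Index d k -> _).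
Let poly_q j := poly_in_qform X inl (xi j).

Let poly_D j : poly_in X [set: _]%SET (D j).
Proof. exact: poly_inB (poly_in_setT (poly_q j)) (poly_in_setT poly_tr). Qed.

(** The errors share g and so need not be independent, but [D j'] involves no variable of query [j],
    so it serves as a test polynomial against the centred [D j]. *)
Let E_D_orth j j' : j != j' -> \int[P]_w (D j' w * D j w) = 0.
Proof.
move=> jj'.
apply: (E_mul_centered mX indep iX (gi := inl) (@xi_inj j) _ (x1 j) (x2 j)) => //.
apply: poly_inB.
  apply: sub_poly_in (poly_q j'); apply/fintype.subsetP => s; rewrite !inE => Hs.
  apply/negP => /finset.bigcupP[i _ /imsetP[a _ sE]]; move: Hs; rewrite sE.
  move=> /orP[/imsetP[]//|/finset.bigcupP[i' _ /imsetP[b _ [e _ _]]]].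
  by rewrite e eqxx in jj'.
apply: sub_poly_in poly_tr; apply/fintype.subsetP => s; rewrite !inE => Hs.
apply/negP => /finset.bigcupP[i _ /imsetP[a _ sE]]; move: Hs; rewrite sE.
by move=> /imsetP[].
Qed.

Let E_D2 j : \int[P]_w (D j w ^+ 2) <= 3 * V.
Proof.
apply: (@le_trans _ _ (3 * (d ^ 2 + 2 * d)%:R ^+ k)); last first.
  by rewrite ler_wpM2l// fourth_moment_rate_le.
apply: (E_centered2_le mX indep iX (gi := inl) (xi := xi j)) => //.
- by move=> J K [].
- exact: xi_inj.
- by move=> J; exact: (std_normal_E1 (ng J)).
- by move=> J; exact: (std_normal_E2 (ng J)).
- by move=> J; exact: (std_normal_E3 (ng J)).
- by move=> J; exact: (std_normal_E4 (ng J)).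
- by move=> i a; exact: (entry_law_E4 (ex j i a)).
Qed.

Let lR0 : 0 < l%:R :> R. Proof. by rewrite ltr0n. Qed.

Let HE w : (H w - tr w) ^+ 2 = \sum_j \sum_j' l%:R ^- 2 * (D j' w * D j w).
Proof.
have -> : H w - tr w = l%:R^-1 * \sum_j D j w.
  rewrite /H /hutch sumrB mulrBr sumr_const card_ord -[tr w *+ l]mulr_natl mulrA.
  by rewrite mulVf ?mul1r// gt_eqF.
rewrite exprMn exprVn [X in _ * X]expr2 mulr_suml mulr_sumr; apply: eq_bigr => j _.
by rewrite mulrA mulr_sumr; apply: eq_bigr => j' _; rewrite -mulrA [D j w * _]mulrC.
Qed.

Let poly_DD j j' : poly_in X [set: _]%SET (fun w => l%:R ^- 2 * (D j' w * D j w)).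
Proof. by apply: poly_inM; [exact: poly_in_cst|exact: poly_inM]. Qed.

Let poly_Z : poly_in X [set: _]%SET (fun w => (H w - tr w) ^+ 2).
Proof.
under eq_fun do rewrite HE.
by apply: poly_in_sum => j; apply: poly_in_sum => j'.
Qed.

Lemma E_hutch_sqr_error_le : \int[P]_w ((H w - tr w) ^+ 2) <= 3 * V / l%:R.
Proof.
under eq_Rintegral do rewrite HE.
rewrite (E_poly_sum mX indep iX (S := [set: _]%SET)); last first.
  by move=> j; apply: poly_in_sum => j'.
have -> : 3 * V / l%:R = \sum_(j < l) l%:R ^- 2 * (3 * V).
  by rewrite sumr_const card_ord -mulr_natl; field; rewrite gt_eqF.
apply: ler_sum => j _.
rewrite (E_poly_sum mX indep iX (S := [set: _]%SET))//.
rewrite (bigD1 j)//= big1 ?addr0; last first.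
  move=> j' jj'; rewrite (E_polyZ mX indep iX _ (S := [set: _]%SET)).
    by rewrite E_D_orth 1?eq_sym// mulr0.
  exact: poly_inM.
rewrite (E_polyZ mX indep iX _ (S := [set: _]%SET)); last exact: poly_inM.
by rewrite ler_wpM2l ?E_D2// invr_ge0 exprn_ge0.
Qed.

Lemma hutch_bound (eps : R) : 0 < eps < 1 ->
  24 * 512 ^+ 2 * eps ^- 2 * (2 + d%:R^-1) ^+ k <= l%:R ->
  ((3 / 4)%:E <= P [set w | ((1 - eps) * trace (gram (fun J => g J w))
     <= hutch (gram (fun J => g J w)) (fun j i a => x j i a w)
     <= (1 + eps) * trace (gram (fun J => g J w)))%R])%E.
Proof.
move=> /andP[e0 e1] le.
have V0 : 0 < V.
  by rewrite mulr_gt0 ?rate_gt0// exprn_gt0// ltr0n expn_gt0 d0.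
have iZ := poly_in_integrable mX indep iX poly_Z.
have mZ := poly_in_measurable mX indep iX poly_Z.
have mtr : measurable_fun setT tr by apply: measurable_trace => J; case: (ng J).
have mH : measurable_fun setT H.
  apply: measurable_funM => //; apply: measurable_sum => j.
  exact: (poly_in_measurable mX indep iX (poly_q j)).
have a0 : 0 < 24 * V / l%:R by rewrite divr_gt0// mulr_gt0.
have PZ : (P [set w | (24 * V / l%:R <= (H w - tr w) ^+ 2)%R] <= (1 / 8)%:E)%E.
  apply: (markov_inequality a0 iZ (fun w => sqr_ge0 _)).
  apply: le_trans E_hutch_sqr_error_le _; rewrite le_eqVlt; apply/orP; left.
  by apply/eqP; field; rewrite gt_eqF.
have -> : 3 / 4 = 1 - (1 / 8 + 1 / 8) :> R by field.
apply: (probability_ge_complement _ _ _ _ PZ (trace_small_ball d0 ng)).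
- rewrite (_ : [set _ | _] = [set w | (1 - eps) * tr w <= H w] `&`
      [set w | H w <= (1 + eps) * tr w]); last first.
    by apply/seteqP; split => w /= => [/andP[]|[? ?]]//; apply/andP.
  by apply: measurableI; apply: measurable_le_fun => //; exact: measurable_funM.
- exact: measurable_le_fun.
- exact: measurable_lt_fun.
- move=> w /= Aw; apply: contrapT => /not_orP[/negP h1 /negP h2]; apply: Aw; move: h1 h2.
  rewrite -/(tr w) -/(H w) -ltNge -leNgt => ZV trw.
  have r0 := rate_gt0 R d k.
  have D0 : 0 < (d ^ k)%:R :> R by rewrite ltr0n expn_gt0 d0.
  have tr0 : 0 < tr w by lra.
  have D2 : (d ^ k)%:R ^+ 2 <= 512 ^+ 2 * tr w ^+ 2 by nra.
  have VT : V <= 512 ^+ 2 * tr w ^+ 2 * (2 + d%:R^-1) ^+ k by rewrite /V ler_wpM2r// ltW.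
  have le' : 24 * 512 ^+ 2 * (2 + d%:R^-1) ^+ k <= l%:R * eps ^+ 2.
    by rewrite -ler_pdivrMr ?exprn_gt0// mulrAC.
  (* The sample size enters here: with [VT], [le'] turns the Markov threshold 24 V / l into at most
     [(eps * tr w) ^+ 2]. *)
  have Zeps : (H w - tr w) ^+ 2 <= (eps * tr w) ^+ 2.
    apply: le_trans (ltW ZV) _; rewrite ler_pdivrMr// exprMn.
    have t2 := sqr_ge0 (tr w); nra.
  have : `|H w - tr w| <= eps * tr w.
    rewrite -(@ler_pXn2r _ 2) ?nnegrE// ?real_normK ?num_real//.
    by rewrite mulr_ge0// ltW.
  rewrite ler_norml => /andP[h1 h2]; apply/andP; split; lra.
Qed.

End hutchinson.

(** The constant is rational so that it can be chosen before [R]; its positivity is used both in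
    [rat] and in [R]. *)
Lemma constant_gt0 (F : numFieldType) : 0 < 24 * 512 ^+ 2 :> F.
Proof. exact: (mulr_gt0 (ltr0Sn _ _) (exprn_gt0 _ (ltr0Sn _ _))). Qed.

Lemma rmorph_constant (F F' : numFieldType) (f : {rmorphism F -> F'}) :
  f (24 * 512 ^+ 2) = 24 * 512 ^+ 2.
Proof. by rewrite rmorphM rmorphXn !rmorph_nat. Qed.

Theorem theorem3 :
  exists C : rat, 0 < C /\
  forall (R : realType) (d k : nat), (0 < d)%N -> forall (kind : 'I_k -> bool),
  (* (i) *)
  (forall (dT : measure_display) (T : measurableType dT) (P : probability T R)
     (g : Index d k -> T -> R) (x : 'I_k -> 'I_d -> T -> R),
     mutually_independent P (joint1 g x) ->
     (forall J, std_normal_rv P (g J)) ->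
     (forall i a, entry_law P (kind i) (x i a)) ->
     (P [set w | (cond_var P x (fun J => g J w) <=
          (ratr C * (2 + d%:R^-1) ^+ k * (trace (gram (fun J => g J w))) ^+ 2)%:E)%E]
        >= (3 / 4)%:E)%E)
  /\
  (* (ii) *)
  (forall (eps : R), 0 < eps < 1 ->
   forall (l : nat), ratr C * eps ^- 2 * (2 + d%:R^-1) ^+ k <= l%:R ->
   forall (dT : measure_display) (T : measurableType dT) (P : probability T R)
     (g : Index d k -> T -> R) (x : 'I_l -> 'I_k -> 'I_d -> T -> R),
     mutually_independent P (jointl g x) ->
     (forall J, std_normal_rv P (g J)) ->
     (forall j i a, entry_law P (kind i) (x j i a)) ->
     (P [set w | ((1 - eps) * trace (gram (fun J => g J w))
                   <= hutch (gram (fun J => g J w)) (fun j i a => x j i a w)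
                   <= (1 + eps) * trace (gram (fun J => g J w)))%R]
        >= (2 / 3)%:E)%E).
Proof.
exists (24 * 512 ^+ 2); split=> [|R d k d0 kind]; first exact: constant_gt0.
have CE : ratr (24 * 512 ^+ 2 : rat) = 24 * 512 ^+ 2 :> R.
  exact: rmorph_constant.
rewrite CE; split.
  by move=> dT T P g x indep ng ex; exact: (cond_var_bound d0 indep ng ex).
move=> eps e01 l le dT T P g x indep ng ex.
(* The lower bound on [l] is positive, which excludes the empty average, where [hutch] would be 0 by
   the convention on inverses. *)
have l0 : (0 < l)%N.
  rewrite -(ltr0n R); apply: lt_le_trans le.
  have e2 : 0 < eps ^- 2 by case/andP: e01 => e0 _; rewrite invr_gt0 exprn_gt0.
  exact: (mulr_gt0 (mulr_gt0 (constant_gt0 R) e2) (rate_gt0 R d k)).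
apply: le_trans (hutch_bound d0 l0 indep ng ex e01 le).
by rewrite lee_fin; lra.
Qed.
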